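(* A generic element of $\mathrm{Bir}_2$ does not possess an invariant fibration. More precisely, a generic element of $\mathrm{Bir}_2$ does not possess any invariant algebraic foliation.
   Context: $\mathrm{Rat}_2\simeq\mathbb{P}^{17}(\mathbb{C})$ is the projectivization of the space of triples $(f_0,f_1,f_2)$ of homogeneous polynomials of degree $2$ in $\mathbb{C}[x_0,x_1,x_2]$, and $\mathrm{Bir}_2\subset\mathrm{Rat}_2$ is the set of those $f$ such that the rational map of $\mathbb{P}^2(\mathbb{C})$ obtained by dividing the $f_i$ by their gcd is birational. ''Generic'' means: in the complement of a countable union of proper algebraic subsets of $\mathrm{Bir}_2$. An algebraic foliation on $\mathbb{P}^2(\mathbb{C})$ is given by a nonzero rational $1$-form $\omega$ (up to multiplication by a nonzero rational function); it is invariant under a birational map $\phi$ if $\phi^*\omega\wedge\omega=0$. A fibration (given by a non-constant rational function $\pi$ to a curve) defines such a foliation by $\mathrm{d}\pi$, and it is invariant if that foliation is. *)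

(* Defs.v *)
From HB Require Import structures.
From mathcomp Require Import all_boot all_algebra.
From mathcomp Require Export fraction reals.
From mathcomp Require Export complex.
From mathcomp.multinomials Require Export mpoly.

Set Implicit Arguments.
Unset Strict Implicit.
Unset Printing Implicit Defensive.

Import GRing.Theory.
Local Open Scope ring_scope.

Section RationalMaps.
Variable F : fieldType.

(* [f_0 : f_1 : f_2] with components homogeneous of the same degree [d]; two
   triples represent the same rational map of P^2 when they differ by a
   nonzero common factor. *)
Definition rational_map (d : nat) (f : 3.-tuple {mpoly F[3]}) : Prop :=
  (forall i, tnth f i \is d.-homog) /\ (exists i, tnth f i != 0).

(* f \o g is the identity as a rational map.  As [g] is never the zero triple,
   [P != 0] also ensures that the composition makes sense. *)
Definition comp_is_id (f g : 3.-tuple {mpoly F[3]}) : Prop :=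
  exists2 P : {mpoly F[3]}, P != 0 & forall i, tnth f i \mPo g = P * 'X_i.

Definition birational (d : nat) (f : 3.-tuple {mpoly F[3]}) : Prop :=
  rational_map d f /\
  exists e (g : 3.-tuple {mpoly F[3]}),
    [/\ rational_map e g, comp_is_id f g & comp_is_id g f].

Definition mdivides (p q : {mpoly F[3]}) : Prop := exists r, q = r * p.

Definition is_gcd (h : {mpoly F[3]}) (f : 3.-tuple {mpoly F[3]}) : Prop :=
  (forall i, mdivides h (tnth f i)) /\
  (forall k, (forall i, mdivides k (tnth f i)) -> mdivides k h).

(* Points of Rat_2 = P^17 are handled through their representatives: nonzero
   triples of quadratic forms.  Every predicate on them used below is invariant
   under multiplication of the triple by a nonzero scalar. *)
Definition Rat2 (f : 3.-tuple {mpoly F[3]}) : Prop := rational_map 2 f.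

Definition Bir2 (f : 3.-tuple {mpoly F[3]}) : Prop :=
  Rat2 f /\
  exists d h (g : 3.-tuple {mpoly F[3]}),
    [/\ is_gcd h f, forall i, tnth f i = h * tnth g i & birational d g].

Definition mon2 (i j : 'I_3) : 'X_{1..3} := (U_(i) + U_(j))%MM.

Definition quad_monomials : 6.-tuple 'X_{1..3} :=
  [tuple mon2 0 0; mon2 0 1; mon2 0 2; mon2 1 1; mon2 1 2; mon2 2 2].

(* The 3 * 6 = 18 homogeneous coordinates on P^17. *)
Definition rat2_coords (f : 3.-tuple {mpoly F[3]}) : 'rV[F]_(3 * 6) :=
  mxvec (\matrix_(i < 3, k < 6) (tnth f i)@_(tnth quad_monomials k)).

(* Closed subsets of Bir2 for the topology induced by the Zariski topology of
   P^17. *)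
Definition algebraic_subset_Bir2 (Z : 3.-tuple {mpoly F[3]} -> Prop) : Prop :=
  exists S : {mpoly F[3 * 6]} -> Prop,
    (forall p, S p -> exists d : nat, p \is d.-homog) /\
    (forall f, Z f <->
       Bir2 f /\ forall p, S p -> p.@[fun k => rat2_coords f ord0 k] = 0).

Definition proper_in_Bir2 (Z : 3.-tuple {mpoly F[3]} -> Prop) : Prop :=
  exists2 f, Bir2 f & ~ Z f.

Definition generic_Bir2 (P : 3.-tuple {mpoly F[3]} -> Prop) : Prop :=
  exists Z : nat -> 3.-tuple {mpoly F[3]} -> Prop,
    (forall n, algebraic_subset_Bir2 (Z n) /\ proper_in_Bir2 (Z n)) /\
    (forall f, Bir2 f -> (forall n, ~ Z n f) -> P f).

End RationalMaps.

Section Foliations.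
Variable F : fieldType.

(* The function field of P^2, in the affine coordinates x = x_1 / x_0 (which is
   'X_0 below) and y = x_2 / x_0 (which is 'X_1 below). *)
Definition funfield := {fraction {mpoly F[2]}}.

Definition ratconst (c : F) : funfield := FracField.tofrac (c%:MP).
Definition ratcoord (j : 'I_2) : funfield := FracField.tofrac ('X_j).

(* Partial derivatives, by the quotient rule on a representative n / d. *)
Definition rderiv (j : 'I_2) (r : funfield) : funfield :=
  let n := \n_(repr r) in let d := \d_(repr r) in
  FracField.tofrac (n^`M(j) * d - n * d^`M(j)) / FracField.tofrac (d ^+ 2).

(* r \o phi.  It does not depend on the representative n / d as soon as no
   nonzero polynomial vanishes at [phi], i.e. as soon as the rational map with
   components [phi] is dominant. *)
Definition rcomp (phi : 'I_2 -> funfield) (r : funfield) : funfield :=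
  mmap ratconst phi \n_(repr r) / mmap ratconst phi \d_(repr r).

(* p(1, x, y) *)
Definition dehomog (p : {mpoly F[3]}) : funfield :=
  mmap ratconst (tnth [tuple 1; ratcoord 0; ratcoord 1]) p.

(* The components f_1 / f_0 and f_2 / f_0 in the affine chart; a common factor
   of the f_i cancels, and f_0 is nonzero when f is in Bir2. *)
Definition affine_map (f : 3.-tuple {mpoly F[3]}) (i : 'I_2) : funfield :=
  dehomog (tnth f (lift ord0 i)) / dehomog (tnth f ord0).

(* Rational 1-forms w = w_0 dx + w_1 dy on P^2. *)
Definition ratform := 'rV[funfield]_2.

Definition pullback (phi : 'I_2 -> funfield) (w : ratform) : ratform :=
  \row_j \sum_(i < 2) rcomp phi (w ord0 i) * rderiv j (phi i).

(* The coefficient of dx /\ dy in w /\ e. *)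
Definition wedge (w e : ratform) : funfield :=
  w ord0 0 * e ord0 1 - w ord0 1 * e ord0 0.

Definition rdifferential (r : funfield) : ratform := \row_j rderiv j r.

Definition invariant_form (f : 3.-tuple {mpoly F[3]}) (w : ratform) : Prop :=
  wedge (pullback (affine_map f) w) w = 0.

(* A foliation is a class of nonzero forms modulo nonzero rational functions;
   [invariant_form f] is constant on such classes for f in Bir2. *)
Definition has_invariant_foliation (f : 3.-tuple {mpoly F[3]}) : Prop :=
  exists2 w : ratform, w != 0 & invariant_form f w.

Definition nonconstant (r : funfield) : Prop := forall c : F, r <> ratconst c.

Definition alg_dependent (r s : funfield) : Prop :=
  exists2 P : {mpoly F[2]}, P != 0 & mmap ratconst (tnth [tuple r; s]) P = 0.

(* A non-constant rational map (p_0, ..., p_(n-1)) from P^2 to a curve in affine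
   n-space: the p_i generate an extension of F of transcendence degree 1.  A
   single non-constant rational function is the case n = 1. *)
Definition fibration (n : nat) (p : 'I_n -> funfield) : Prop :=
  (exists i, nonconstant (p i)) /\ (forall i j, alg_dependent (p i) (p j)).

(* In characteristic 0, the non-constant components p_i have nonzero proportional
   differentials, so that any of them defines the foliation of the fibration. *)
Definition has_invariant_fibration (f : 3.-tuple {mpoly F[3]}) : Prop :=
  exists n (p : 'I_n -> funfield),
    fibration p /\
    exists2 i, nonconstant (p i) & invariant_form f (rdifferential (p i)).

End Foliations.

(* Main.v *)
(** Fix a bound [d].  The forms a dx + b dy with coefficients of degree at most
    [d] that are invariant under a quadratic map f are the common zeros of
    quadratic forms in the coefficients of (a, b), with coefficients polynomial
    in those of f.  If at some f0 this system has only the zero solution, over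
    every extension of the base field, then all monomials of some degree in the
    unknowns lie in the ideal of the system at f0, and writing this as a matrix
    identity and taking a determinant gives a polynomial [P] with [P f0 <> 0]
    which vanishes at every f having a nonzero invariant form of degree at most
    [d].  Since this condition on f is conic, the homogeneous components of [P]
    vanish there as well.  The union over [d] is the countable union sought.

    It remains to find f0 in Bir_2 without invariant foliation: the map
    (x, y) |-> (y, x y + 1).  Let (a, b) be coprime and invariant.  The line
    [y = 0] is contracted to (0, 1), whose orbit is infinite; hence that line and
    all its preimages h_(n+1) = 0 are invariant curves, where h_0 = x, h_1 = y and
    h_(n+2) = h_(n+1) h_n + 1.  For X = b d/dx - a d/dy this says
    X(h_(n+1)) = k_n h_(n+1), where the degree of k_n in y is bounded.  Applying X
    to the recursion gives
    k_(n+2) = h_(n+2) h_(n+1) (k_n + k_(n+1) - k_(n+2)),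
    so k_n = 0 for large n, and then X = 0. *)

From HB Require Import structures.
Require Import Defs.
From mathcomp Require Import all_boot all_order all_algebra.
From mathcomp Require Import polyXY ring_quotient ring zify.
From mathcomp Require Import boolp classical_sets.

Set Implicit Arguments.
Unset Strict Implicit.
Unset Printing Implicit Defensive.

Import GRing.Theory.
Local Open Scope ring_scope.

(** * The map (x, y) |-> (y, x y + 1) has no invariant form *)

Section SpecialMap.
Variable K : fieldType.
Hypothesis K0 : [pchar K] =i pred0.

Local Notation A := {poly {poly K}}.
Local Notation x := (('X)%:P : A).
Local Notation y := ('X : A).

(** The inner variable is [x] and the outer one [y]: replacing [y] by [x * y + 1] and then
    exchanging the variables turns [p (x, y)] into [p (y, x * y + 1)]. *)
Definition special_pullback : A -> A :=
  fun p => swapXY (p \Po ('X%:P * 'X + 1)).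
Local Notation fs := special_pullback.

Fact special_pullback_zmod : zmod_morphism fs.
Proof. by move=> p q; rewrite /fs comp_polyB raddfB. Qed.
Fact special_pullback_monoid : monoid_morphism fs.
Proof.
by split=> [|p q]; rewrite /fs ?comp_polyM ?rmorphM // comp_polyC swapXY_polyC map_polyC.
Qed.
HB.instance Definition _ :=
  GRing.isZmodMorphism.Build A A fs special_pullback_zmod.
HB.instance Definition _ :=
  GRing.isMonoidMorphism.Build A A fs special_pullback_monoid.

Lemma special_pullbackD p q : fs (p + q) = fs p + fs q. Proof. exact: rmorphD. Qed.
Lemma special_pullbackB p q : fs (p - q) = fs p - fs q. Proof. exact: rmorphB. Qed.
Lemma special_pullbackN p : fs (- p) = - fs p. Proof. exact: rmorphN. Qed.
Lemma special_pullbackM p q : fs (p * q) = fs p * fs q. Proof. exact: rmorphM. Qed.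
Lemma special_pullback_exp p n : fs (p ^+ n) = fs p ^+ n. Proof. exact: rmorphXn. Qed.
Lemma special_pullback0 : fs 0 = 0. Proof. exact: rmorph0. Qed.
Lemma special_pullback1 : fs 1 = 1. Proof. exact: rmorph1. Qed.

Lemma special_pullbackX : fs x = y.
Proof. by rewrite /fs comp_polyC swapXY_Y. Qed.

Lemma special_pullbackY : fs y = x * y + 1.
Proof.
by rewrite /fs comp_polyX rmorphD rmorphM rmorph1 /= swapXY_X swapXY_Y mulrC.
Qed.

Lemma special_pullbackC (c : K) : fs c%:P%:P = c%:P%:P.
Proof. by rewrite /fs comp_polyC swapXY_polyC map_polyC. Qed.

Lemma special_pullback_eq0 p : (fs p == 0) = (p == 0).
Proof.
rewrite /fs swapXY_eq0 comp_poly_eq0 //.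
have X0 : ('X : {poly K}) != 0 by rewrite polyX_eq0.
by rewrite -polyC1 size_MXaddC polyC_eq0 (negPf X0) size_polyC X0.
Qed.

Lemma special_pullback_inj : injective fs.
Proof.
move=> p q /eqP; rewrite -subr_eq0 -special_pullbackB special_pullback_eq0 subr_eq0.
by move/eqP.
Qed.

Lemma horner2_comp (p : A) (r : {poly K}) (b : K) :
  p.[r].[b] = p.[r.[b]%:P].[b].
Proof.
elim/poly_ind: p => [|p c IHp]; first by rewrite !horner0.
by rewrite !hornerMXaddC !hornerD !hornerM IHp hornerC.
Qed.

Lemma horner2_special_pullback (p : A) (a b : K) :
  (fs p).[b%:P].[a] = p.[(a * b + 1)%:P].[b].
Proof.
rewrite /fs horner2_swapXY horner_comp.
have -> : ('X%:P * 'X + 1 : A).[a%:P] = 'X * a%:P + 1 by rewrite !hornerE.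
by rewrite [LHS]horner2_comp !hornerE mulrC.
Qed.

(** The inverse map is [(x, y) |-> ((y - 1) / x, x)]: its only denominators are powers of [x], which
    pull back to powers of [y]. In the induction a factor [x] costs one factor [y], since
    [fs (y - 1) = x * y]. *)
Lemma special_pullback_birational (u : A) : exists k v, u * y ^+ k = fs v.
Proof.
have sumP (u1 u2 : A) : (exists k v, u1 * y ^+ k = fs v) ->
    (exists k v, u2 * y ^+ k = fs v) -> exists k v, (u1 + u2) * y ^+ k = fs v.
  move=> [k [v Hv]] [l [w Hw]]; exists (k + l)%N, (v * x ^+ l + w * x ^+ k).
  rewrite special_pullbackD !special_pullbackM !special_pullback_exp.
  rewrite special_pullbackX -Hv -Hw exprD; ring.
elim/poly_ind: u => [|u c [k [v IHu]]]; first by exists 0, 0; rewrite mul0r special_pullback0.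
apply: (sumP _ _).
  by exists k, (v * x); rewrite special_pullbackM special_pullbackX -IHu; ring.
elim/poly_ind: c => [|c e [l [w IHc]]].
  by exists 0, 0; rewrite mul0r special_pullback0.
rewrite polyCD polyCM; apply: (sumP _ _); last first.
  by exists 0, e%:P%:P; rewrite special_pullbackC mulr1.
exists l.+1, (w * (y - 1)).
rewrite special_pullbackM special_pullbackB special_pullback1 -IHc special_pullbackY exprS; ring.
Qed.

(* [heights n] is [fs] iterated [n] times on [x]: its zero locus is the n-th
   preimage of the line [x = 0]. *)
Fixpoint heights_pair n : A * A :=
  if n is n'.+1 then
    let: (h, h') := heights_pair n' in (h', h' * h + 1) else (x, y).
Definition heights n := (heights_pair n).1.
Local Notation h := heights.

Lemma heightsSS n : h n.+2 = h n.+1 * h n + 1.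
Proof. by rewrite /h /=; case: (heights_pair n). Qed.

Lemma special_pullback_heights n : fs (h n) = h n.+1.
Proof.
have [] // : fs (h n) = h n.+1 /\ fs (h n.+1) = h n.+2.
elim: n => [|n [IH0 IH1]].
  by rewrite heightsSS special_pullbackX special_pullbackY mulrC.
split=> //; rewrite heightsSS special_pullbackD special_pullbackM special_pullback1.
by rewrite IH0 IH1 -heightsSS.
Qed.

(** On the line [y = 0] the recursion takes the values 1, 1, 2, 3, 7, ... from [h 2] on; two
    consecutive values are carried through the induction. *)
Lemma heights_at0 n : exists2 k, (0 < k)%N & (h n.+2).[0] = k%:R.
Proof.
suff [k [l [k0 -> _]]] : exists k l,
  [/\ (0 < k)%N, (h n.+2).[0] = k%:R & (h n.+3).[0] = l%:R /\ (0 < l)%N].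
  by exists k.
have [h1 h2] : (h 1).[0] = 0 /\ (h 2).[0] = 1%:R.
  by rewrite heightsSS /h /= !hornerE.
have h3 : (h 3).[0] = 1%:R by rewrite heightsSS hornerD hornerM h1 hornerC mulr0 add0r.
elim: n => [|n [k [l [k0 Hk [Hl l0]]]]]; first by exists 1, 1.
exists l, (l * k + 1)%N; split=> //.
by rewrite addn1; split=> //; rewrite heightsSS !hornerE Hk Hl -natrM -natr1.
Qed.

Lemma size_mulD1 (p q : A) : (1 < size p)%N -> (0 < size q)%N ->
  size (p * q + 1) = (size p + size q).-1.
Proof.
move=> p1 q0; have p0 : (0 < size p)%N := ltnW p1.
have e : size (p * q) = (size p + size q).-1.
  by rewrite size_mul // -size_poly_gt0.
rewrite size_polyDl e // size_poly1.
by case: (size p) p1 => [|[|a]] // _; case: (size q) q0 => // b _; rewrite addnS.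
Qed.

(** Sizes measure the degree in [y]. These degrees add along the recursion, so they are the
    Fibonacci numbers. *)
Lemma size_heights_aux n : (1 < size (h n.+1))%N /\ (n.+1 < size (h n.+2))%N.
Proof.
elim: n => [|n [b c]].
  rewrite heightsSS size_mulD1 ?size_polyX // /h /= size_polyC polyX_eq0 //.
have c1 : (1 < size (h n.+2))%N by apply: leq_ltn_trans c.
split=> //; rewrite [h n.+3]heightsSS size_mulD1 //; last exact: ltnW.
move: b c; move: (size (h n.+1)) (size (h n.+2)) => [|[|s]] // [|t] // _ c.
by rewrite addSn !addnS /= !ltnS in c *; apply: leq_trans (leq_addr _ _).
Qed.

Lemma size_heights_gt1 n : (1 < size (h n.+1))%N.
Proof. by case: (size_heights_aux n). Qed.

Lemma size_heights_gt n : (n < size (h n.+1))%N.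
Proof. by case: n => [|n]; rewrite ?size_polyX //; case: (size_heights_aux n). Qed.

Definition divides (p q : A) := exists r, q = r * p.

(* [h n.+2] is a nonzero constant on [y = 0], in characteristic zero. *)
Lemma heights_dvd_mulY n u k : divides (h n.+2) (u * y ^+ k) -> divides (h n.+2) u.
Proof.
elim: k u => [|k IHk] u; first by rewrite mulr1.
rewrite exprSr mulrA => -[r Hr]; apply: IHk.
have [c c0 Hc] := heights_at0 n.
have r0 : r.[0] = 0.
  have := congr1 (fun p : A => p.[0]) Hr; rewrite /= !hornerM Hc hornerX mulr0.
  move/esym/eqP; rewrite mulf_eq0 => /orP[/eqP //|].
  rewrite -polyC_natr polyC_eq0 ((pcharf0P K).1 K0) => /eqP e.
  by rewrite e in c0.
have [s Hs] : exists s, r = s * y.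
  by move/eqP: r0 => /factor_theorem [s ->]; exists s; rewrite subr0.
exists s; apply: (mulIf (x := y)); first by rewrite polyX_eq0.
by rewrite Hr Hs mulrAC.
Qed.

(** Induction from the prime [y]: a divisibility by [h n.+2] is carried through the inverse map to
    one by [h n.+1]. Clearing denominators introduces powers of [x] before pulling back and powers
    of [y] after; both can be discarded. *)
Lemma heights_prime n u v :
  divides (h n.+1) (u * v) -> divides (h n.+1) u \/ divides (h n.+1) v.
Proof.
elim: n u v => [|n IHn] u v.
  case=> r Hr; have := congr1 (fun p : A => p.[0]) Hr; rewrite /h /= !hornerM hornerX mulr0.
  move/eqP; rewrite mulf_eq0 => /orP[] /factor_theorem [s ->]; rewrite subr0.
    by left; exists s.
  by right; exists s.
case=> r Hr.
have [k [u1 Hu]] := special_pullback_birational u.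
have [l [v1 Hv]] := special_pullback_birational v.
have [m [r1 Hr1]] := special_pullback_birational r.
have e : x ^+ m * (u1 * v1) = x ^+ (k + l) * r1 * h n.+1.
  apply: special_pullback_inj; rewrite !special_pullbackM !special_pullback_exp special_pullbackX.
  rewrite special_pullback_heights -Hu -Hv -Hr1 exprD.
  transitivity (y ^+ m * y ^+ k * y ^+ l * (u * v)); first by ring.
  by rewrite Hr; ring.
(* [x ^+ j] has degree 0 in [y], whereas [h n.+1] has positive degree. *)
have xN j : ~ divides (h n.+1) (x ^+ j).
  case=> s Hs; have := size_heights_gt1 n; apply/negP; rewrite -leqNgt.
  have xj : x ^+ j != 0 by rewrite expf_neq0 // polyC_eq0 polyX_eq0.
  have s0 : s != 0 by apply: contra_neq xj => s0; rewrite Hs s0 mul0r.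
  have h0 : h n.+1 != 0 by apply: contra_neq xj => s1; rewrite Hs s1 mulr0.
  have : (size (x ^+ j) <= 1)%N by rewrite -polyC_exp size_polyC leq_b1.
  rewrite Hs size_mul // -[size s]prednK ?size_poly_gt0 //.
  by rewrite addSn /= => /(leq_trans (leq_addl _ _)).
have [/xN // | [w Hw]|[w Hw]] : [\/ divides (h n.+1) (x ^+ m), divides (h n.+1) u1 | divides (h n.+1) v1].
- have /IHn[|/IHn[]] : divides (h n.+1) (x ^+ m * (u1 * v1)) by eexists; exact: e.
  + by constructor 1.
  + by constructor 2.
  + by constructor 3.
- left; apply: (@heights_dvd_mulY _ _ k); exists (fs w).
  by rewrite Hu Hw special_pullbackM special_pullback_heights.
- right; apply: (@heights_dvd_mulY _ _ l); exists (fs w).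
  by rewrite Hv Hw special_pullbackM special_pullback_heights.
Qed.

(** The coefficient of [dx /\ dy] in the wedge of the pulled back form with the form
    [ab.1 dx + ab.2 dy] itself is zero. *)
Definition invariant_pair (ab : A * A) : Prop :=
  y * fs ab.2 * ab.2 = (fs ab.1 + x * fs ab.2) * ab.1.

(* Pullback of [ab.1 dx + ab.2 dy] by the map [(x, y) |-> (y, x * y + 1)]. *)
Definition pull (ab : A * A) : A * A := (y * fs ab.2, fs ab.1 + x * fs ab.2).

Definition vanishes_at (ab : A * A) (p : K * K) : Prop :=
  ab.1.[p.2%:P].[p.1] = 0 /\ ab.2.[p.2%:P].[p.1] = 0.

(** The Jacobian determinant of the map is [- y], which is invertible off the line [y = 0]. *)
Lemma pull_vanishes ab (p : K * K) : p.2 != 0 -> vanishes_at (pull ab) p ->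
  vanishes_at ab (p.2, p.1 * p.2 + 1).
Proof.
case: p => a b /= b0 []; rewrite /vanishes_at /=.
rewrite !hornerD !hornerM !horner2_special_pullback hornerX !hornerC => /eqP.
rewrite mulf_eq0 (negPf b0) /= => /eqP Hb; rewrite Hb mulr0 addr0 => Ha.
by split.
Qed.

(** The orbit of [(0, 1)], the point to which [y = 0] is contracted, computed in [nat] so that
    positivity and growth make sense over any [K]. *)
Fixpoint orbit_nat n : nat * nat :=
  if n is n'.+1 then let: (a, b) := orbit_nat n' in (b, a * b + 1)%N else (0, 1)%N.

Definition orbit_pt n : K * K := ((orbit_nat n).1%:R, (orbit_nat n).2%:R).

Lemma orbit_natS n :
  orbit_nat n.+1 = ((orbit_nat n).2, (orbit_nat n).1 * (orbit_nat n).2 + 1)%N.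
Proof. by rewrite /=; case: orbit_nat. Qed.

Lemma orbit_nat_gt0 n : (0 < (orbit_nat n).2)%N.
Proof. by case: n => // n; rewrite orbit_natS /= addn1. Qed.

(** The first coordinates run 0, 1, 1, 2, 3, 7, ..., so strict growth starts only at index 2. *)
Lemma orbit_nat_lt n : ((orbit_nat n.+2).1 < (orbit_nat n.+3).1)%N.
Proof.
have -> : (orbit_nat n.+3).1 = ((orbit_nat n.+1).1 * (orbit_nat n.+1).2 + 1)%N.
  by rewrite !orbit_natS.
have -> : (orbit_nat n.+2).1 = (orbit_nat n.+1).2 by rewrite !orbit_natS.
by rewrite addn1 ltnS leq_pmull // orbit_natS orbit_nat_gt0.
Qed.

Lemma natr_inj_char0 (m n : nat) : m%:R = n%:R :> K -> m = n.
Proof.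
wlog: m n / (m <= n)%N => [wh e|mn e].
  by case: (leqP m n) => [|/ltnW] /wh; [apply | move=> ->].
have /eqP : (n - m)%:R = 0 :> K by rewrite natrB // e subrr.
by rewrite ((pcharf0P K).1 K0) subn_eq0 => nm; apply/eqP; rewrite eqn_leq mn.
Qed.

(** * Invariant pairs without common factor of positive degree in [y] *)

Section CoprimePair.
Variables a b : A.
Hypothesis ab_inv : invariant_pair (a, b).
Hypothesis ab_coprime : coprimep a b.

Lemma pair_neq0 : a != 0 /\ b != 0.
Proof.
have ab0 : ~ (a = 0 /\ b = 0).
  by case=> a0 b0; move: ab_coprime; rewrite a0 b0 coprimep0 -size_poly_eq1 size_poly0.
move: ab_inv; rewrite /invariant_pair /=.
split; apply/eqP => z; apply: ab0; split=> //.
  move: ab_inv; rewrite /invariant_pair /= z mulr0 => /eqP.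
  rewrite !mulf_eq0 polyX_eq0 special_pullback_eq0 /=.
  by rewrite orbb => /eqP.
move: ab_inv; rewrite /invariant_pair /= z mulr0 special_pullback0 mulr0 addr0 => /esym/eqP.
by rewrite mulf_eq0 special_pullback_eq0 orbb => /eqP.
Qed.

Let a0 : a != 0 := pair_neq0.1.
Let b0 : b != 0 := pair_neq0.2.
Let b'0 : fs b != 0.
Proof. by rewrite special_pullback_eq0. Qed.

Lemma iter_pull_proportional n :
  (iter n pull (a, b)).1 * b = (iter n pull (a, b)).2 * a.
Proof.
elim: n => [|n]; first by rewrite /= mulrC.
rewrite iterS; case: (iter n pull (a, b)) => an bn /= /(congr1 fs).
rewrite !special_pullbackM => IH; apply: (mulIf b'0); move: ab_inv; rewrite /invariant_pair /= => e.
transitivity (fs bn * (y * fs b * b)); first by ring.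
rewrite e; transitivity ((fs bn * fs a) * a + x * fs bn * fs b * a); first by ring.
by rewrite -IH; ring.
Qed.

(* Otherwise all the iterated pullbacks vanish at (0, 1), the image of the
   contracted line [y = 0]; hence [a] and [b] vanish along the infinite orbit of
   that point. *)
Lemma pair_divY : divides y a.
Proof.
have [a_0|a_N0] := eqVneq a.[0] 0.
  by move/eqP: a_0 => /factor_theorem [s ->]; rewrite subr0; exists s.
have init n : vanishes_at (iter n pull (a, b)) (0, 1).
  have := iter_pull_proportional n.+1.
  rewrite iterS; case: (iter n pull (a, b)) => an bn /= /(congr1 (fun p : A => p.[0])).
  rewrite !hornerM hornerX !mul0r => /esym/eqP; rewrite mulf_eq0 (negPf a_N0) orbF.
  move/eqP => e; have e1 c : (fs an + x * fs bn).[0%:P].[c] = 0.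
    by rewrite polyC0 e horner0.
  (* The point [(c, 0)] is mapped to [(0, 1)], so the relation involves only values there; taking
     [c = 0] and [c = 1] separates the two coefficients. *)
  have {}e1 c : an.[1].[0] + c * bn.[1].[0] = 0.
    have := e1 c; rewrite !hornerD !hornerM.
    by rewrite !horner2_special_pullback hornerC hornerX mulr0 add0r polyC1.
  rewrite /vanishes_at /= polyC1.
  have := e1 0; rewrite mul0r addr0 => e2; split=> //.
  by have := e1 1; rewrite e2 add0r mul1r.
have orb m n : vanishes_at (iter n pull (a, b)) (orbit_pt m).
  elim: m n => [|m IHm] n; first exact: init.
  have := IHm n.+1; rewrite iterS => /pull_vanishes /=.
  rewrite -[X in X != 0]/((orbit_nat m).2%:R) ((pcharf0P K).1 K0) -lt0n orbit_nat_gt0 => /(_ isT).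
  by rewrite /orbit_pt orbit_natS /= natrD natrM.
(* Over [K[x]] the Bezout identity holds only up to a nonzero [c2] in [K[x]]. Evaluated along the
   orbit it makes [c2] vanish at infinitely many points. *)
have /Pdiv.Idomain.Bezout_coprimepP [[u v]] := ab_coprime.
move/eqpP => [[c1 c2] /= /andP[c10 c20] e].
have root_c2 m : c2.[(orbit_nat m).1%:R] = 0.
  have [/= Ha Hb] := orb m 0%N.
  have := congr1 (fun p : A => p.[((orbit_pt m).2)%:P].[(orbit_pt m).1]) e.
  rewrite /= !hornerZ !(hornerD, hornerM) Ha Hb !mulr0 addr0 mulr0 !hornerC mulr1.
  by move/esym.
have inj : injective (fun m => (orbit_nat m.+2).1%:R : K).
  move=> m n /natr_inj_char0.
  have mono : {homo (fun m => (orbit_nat m.+2).1) : i j / (i < j)%N}.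
    by apply: homo_ltn => [? ? ?|i]; [apply: ltn_trans | apply: orbit_nat_lt].
  by case: (ltngtP m n) => // /mono lt eq_mn; move: lt; rewrite eq_mn ltnn.
have : c2 = 0.
  apply: (@roots_geq_poly_eq0 _ _ [seq (orbit_nat m.+2).1%:R : K | m <- iota 0 (size c2)]).
  - by apply/allP => _ /mapP[m _ ->]; apply/eqP; exact: root_c2.
  - by rewrite map_inj_uniq // iota_uniq.
  - by rewrite size_map size_iota.
by move/eqP; rewrite (negPf c20).
Qed.

Fixpoint height_deriv_pair n : A * A :=
  if n is n'.+1 then
    let: (u, v) := height_deriv_pair n' in
    (v, h n'.+1 * u + h n' * v) else (b, - a).

(* The derivative of [heights n] along the vector field [b d/dx - a d/dy]. *)
Definition height_deriv n := (height_deriv_pair n).1.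
Local Notation hd := height_deriv.

Lemma height_derivSS n : hd n.+2 = h n.+1 * hd n + h n * hd n.+1.
Proof. by rewrite /hd /=; case: (height_deriv_pair n). Qed.

(** For X = b d/dx - a d/dy, invariance means [fs b * X (fs p) = - a * fs (X p)]. This is immediate
    for [p = x], is the invariance equation for [p = y], and propagates to the heights by the
    Leibniz rule. *)
Lemma special_pullback_deriv n : fs b * hd n.+1 = - a * fs (hd n).
Proof.
suff [] : fs b * hd n.+1 = - a * fs (hd n) /\ fs b * hd n.+2 = - a * fs (hd n.+1) by [].
elim: n => [|n [IH0 IH1]].
  split; first by rewrite mulrC.
  rewrite height_derivSS /hd /h /= special_pullbackN; move: ab_inv; rewrite /invariant_pair /= => E.
  transitivity (y * fs b * b - x * fs b * a); first by ring.
  by rewrite E; ring.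
split=> //; rewrite [hd n.+2]height_derivSS special_pullbackD !special_pullbackM !special_pullback_heights.
rewrite [hd n.+3]height_derivSS.
transitivity (h n.+2 * (fs b * hd n.+1) + h n.+1 * (fs b * hd n.+2)); first by ring.
by rewrite IH0 IH1; ring.
Qed.

(** A companion relation with a second multiplier: [h n.+2] cannot divide both [fs b] and
    [fs a + x * fs b], so one of the two relations always yields information. *)
Lemma special_pullback_deriv2 n : (fs a + x * fs b) * hd n.+1 = - b * y * fs (hd n).
Proof.
apply: (mulIf b'0); move: ab_inv; rewrite /invariant_pair /= => E.
transitivity ((fs a + x * fs b) * (fs b * hd n.+1)); first by ring.
rewrite special_pullback_deriv.
transitivity (- ((fs a + x * fs b) * a * fs (hd n))); first by ring.
by rewrite -E; ring.
Qed.

Lemma heights_ndivides n : divides (h n.+2) (fs a) -> divides (h n.+2) (fs b) -> False.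
Proof.
(* Descending through the inverse map leaves a factor [x ^+ k], a scalar in [K[x]] to which [%|] is
   insensitive. *)
have dvd_of (c : A) : divides (h n.+2) (fs c) -> (h n.+1 %| c)%R.
  case=> u Hu; have [k [v Hv]] := special_pullback_birational u.
  apply/Pdiv.Idomain.dvdpP; exists ('X ^+ k, v) => /=.
    by rewrite expf_neq0 ?polyX_eq0.
  apply: special_pullback_inj; rewrite -mul_polyC polyC_exp !special_pullbackM special_pullback_exp.
  by rewrite special_pullbackX special_pullback_heights Hu -Hv; ring.
move=> /dvd_of da /dvd_of db.
have := dvdp_gcd (h n.+1) a b; rewrite da db /=.
move: ab_coprime; rewrite /coprimep => /eqP g1 dg.
have g0 : gcdp a b != 0 by rewrite -size_poly_eq0 g1.
have := dvdp_leq g0 dg; rewrite g1 leqNgt.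
by rewrite size_heights_gt1.
Qed.

(** The base case is X(y) = -a with [y] dividing [a]. Inductively, the two derivative relations show
    that the prime [h n.+2] divides [hd n.+2], or else both multipliers and hence both [fs a] and
    [fs b], which coprimality forbids. *)
Lemma height_deriv_divisible n : divides (h n.+1) (hd n.+1).
Proof.
elim: n => [|n [k Hk]].
  by have [r Hr] := pair_divY; exists (- r); rewrite /hd /h /= Hr mulNr.
have H1 : divides (h n.+2) (fs b * hd n.+2).
  exists (- a * fs k).
  by rewrite special_pullback_deriv Hk special_pullbackM special_pullback_heights mulrA.
have H2 : divides (h n.+2) ((fs a + x * fs b) * hd n.+2).
  exists (- b * y * fs k).
  by rewrite special_pullback_deriv2 Hk special_pullbackM special_pullback_heights mulrA.
case: (heights_prime H1) => // -[u Hu].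
case: (heights_prime H2) => // -[v Hv].
exfalso; apply: (@heights_ndivides n); last by exists u.
exists (v - x * u).
by rewrite mulrBl -Hv -mulrA -Hu addrK.
Qed.

Let d := maxn (size a) (size b).

(** The Leibniz recursion for [hd] raises degrees exactly as the recursion for [h] does, so the
    initial excess, at most [d], never grows. *)
Lemma size_height_deriv n : (size (hd n.+1) <= size (h n.+1) + d)%N.
Proof.
suff : ((size (hd n) <= size (h n) + d) /\ (size (hd n.+1) <= size (h n.+1) + d))%N by case.
elim: n => [|n [IH0 IH1]].
  rewrite /hd /= size_polyN; split; rewrite (leq_trans _ (leq_addl _ _)) //.
    exact: leq_maxr.
  exact: leq_maxl.
split=> //; rewrite height_derivSS.
have hn0 : (0 < size (h n))%N.
  case: n {IH0 IH1} => [|n]; last exact: ltnW (size_heights_gt1 n).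
  by rewrite /h /= size_polyC polyX_eq0.
rewrite heightsSS size_mulD1 ?size_heights_gt1 //.
have h1 := size_heights_gt1 n.
have m1 := size_mul_leq (h n.+1) (hd n); have m2 := size_mul_leq (h n) (hd n.+1).
apply: leq_trans (size_polyD _ _) _; rewrite geq_max.
by apply/andP; split; [apply: leq_trans m1 _|apply: leq_trans m2 _]; lia.
Qed.

Lemma coprime_pair_false : False.
Proof.
have [k Hk] : exists k, forall n, hd n.+1 = k n * h n.+1.
  by have := choice height_deriv_divisible; case=> k Hk; exists k.
have hN0 n : h n.+1 != 0 by rewrite -size_poly_gt0 ltnW // size_heights_gt1.
have szk n : (size (k n) <= d.+1)%N.
  have [->|kn0] := eqVneq (k n) 0; first by rewrite size_poly0.
  have := size_height_deriv n; rewrite Hk size_mul //.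
  rewrite -size_poly_gt0 in kn0; move: kn0 (size_heights_gt1 n).
  by move: (size _) (size _) => s t; lia.
have rel n : k n.+2 = h n.+2 * h n.+1 * (k n + k n.+1 - k n.+2).
  have := height_derivSS n.+1; rewrite !Hk heightsSS => E.
  transitivity (k n.+2 * (h n.+2 * h n.+1 + 1) - k n.+2 * (h n.+2 * h n.+1)); first by ring.
  by rewrite E; ring.
(* The factor [h d.+2] already has size above [d.+1], which bounds the size of [k d.+2]; so the
   relation [rel d] leaves only zero. *)
have k0 : k d.+2 = 0.
  apply/eqP; apply: contraT => kN0; have := szk d.+2.
  have := rel d; have [->|s0] := eqVneq (k d + k d.+1 - k d.+2) 0.
    by rewrite mulr0 => /eqP; rewrite (negPf kN0).
  move=> E; rewrite E size_mul ?mulf_neq0 // size_mul //.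
  have := size_heights_gt1 d; have := size_heights_gt d.+1; rewrite -size_poly_gt0 in s0.
  move: s0 => /[swap].
  by move: (size _) (size _) (size _) => s t u; lia.
(* Since [a] is nonzero, vanishing descends from [hd d.+3] to [hd 0 = b], a contradiction. *)
have hd0 n : hd n.+1 = 0 -> hd n = 0.
  move=> z; have := special_pullback_deriv n; rewrite z mulr0 => /esym/eqP.
  by rewrite mulf_eq0 oppr_eq0 (negPf a0) special_pullback_eq0 => /eqP.
have : hd d.+3 = 0 by rewrite Hk k0 mul0r.
elim: (d.+2) => [|n IHn] /hd0 //.
by move/eqP; rewrite (negPf b0).
Qed.

End CoprimePair.

Theorem invariant_pair_eq0 (ab : A * A) : invariant_pair ab -> ab = 0.
Proof.
case: ab => a b inv; apply/eqP; apply: contraT => ab0.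
have {}ab0 : (a != 0) || (b != 0).
  by move: ab0; rewrite -pair_eqE /pair_eq /= negb_and.
set g := gcdp a b; have g0 : g != 0 by rewrite gcdp_eq0 negb_and.
have /Pdiv.Idomain.dvdpP [[c1 a1] /= c10 Ha] : (g %| a)%R by exact: dvdp_gcdl.
have /Pdiv.Idomain.dvdpP [[c2 b1] /= c20 Hb] : (g %| b)%R by exact: dvdp_gcdr.
(* Division by the gcd is exact only up to [c1] and [c2] in [K[x]]; the crossed scalars make the new
   pair, times [g], equal to [c1 * c2] times the old one. *)
have inv1 : invariant_pair (c2 *: a1, c1 *: b1).
  have G : g * fs g != 0 by rewrite mulf_neq0 // special_pullback_eq0.
  apply: (mulIf G); rewrite /= in inv *.
  have Ea : (c2 *: a1) * g = (c1 * c2)%:P * a.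
    by rewrite -scalerAl -Ha scalerA mulrC mul_polyC mulrC.
  have Eb : (c1 *: b1) * g = (c1 * c2)%:P * b.
    by rewrite -scalerAl -Hb scalerA mul_polyC.
  have Ea' := congr1 fs Ea; have Eb' := congr1 fs Eb; rewrite !special_pullbackM in Ea' Eb'.
  set cc := (c1 * c2)%:P in Ea Eb Ea' Eb'.
  transitivity (y * (fs (c1 *: b1) * fs g) * (c1 *: b1 * g)); first by ring.
  rewrite Eb Eb'.
  transitivity (fs cc * cc * (y * fs b * b)); first by ring.
  rewrite [y * fs b * b]inv /=.
  transitivity ((fs cc * fs a + x * (fs cc * fs b)) * (cc * a)); first by ring.
  by rewrite -Ea -Ea' -Eb'; ring.
have cop : coprimep a1 b1.
  rewrite -gcdp_eqp1 -(eqp_mul2r _ _ g0) mul1r (eqp_ltrans (mulp_gcdl _ _ _)).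
  by rewrite -Ha -Hb; apply: eqp_gcd; apply: eqp_scale.
by case: (coprime_pair_false inv1); rewrite coprimepZl // coprimepZr.
Qed.

End SpecialMap.

(** * Prime avoidance *)

Section ClassicalDomain.
Variable Q : comNzRingType.
Hypothesis Q_domain : forall x y : Q, x * y = 0 -> (x == 0) || (y == 0).

(** The dummy [let] makes the alias depend on [Q_domain], so that the integral domain structure can
    be attached to it; inverses are chosen classically. *)
Definition classical_domain : Type := let _ := Q_domain in Q.
HB.instance Definition _ := GRing.ComNzRing.on classical_domain.

Definition classical_unit : pred classical_domain := fun x => `[< exists y, y * x = 1 >].
Definition classical_inv (x : classical_domain) : classical_domain :=
  if pselect (exists y, y * x = 1) is left h then projT1 (cid h) else x.

Fact classical_mulVx : {in classical_unit, left_inverse 1 classical_inv *%R}.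
Proof.
move=> x /asboolP h; rewrite /classical_inv; case: pselect => // h'.
by case: (cid h').
Qed.
Fact classical_unitPl (x y : classical_domain) : y * x = 1 -> classical_unit x.
Proof. by move=> h; apply/asboolP; exists y. Qed.
Fact classical_invr_out : {in [predC classical_unit], classical_inv =1 id}.
Proof.
move=> x; rewrite inE /= => /asboolP h.
by rewrite /classical_inv; case: pselect.
Qed.
HB.instance Definition _ := GRing.ComNzRing_hasMulInverse.Build classical_domain
  classical_mulVx classical_unitPl classical_invr_out.
HB.instance Definition _ :=
  GRing.ComUnitRing_isIntegral.Build classical_domain Q_domain.

Lemma domain_embedding :
  exists (K : fieldType) (f : {rmorphism Q -> K}), injective f.
Proof.
exists {fraction classical_domain}.
by exists (@FracField.tofrac classical_domain : {rmorphism classical_domain -> _});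
  move=> x y /eqP; rewrite tofrac_eq => /eqP.
Qed.

End ClassicalDomain.

Section PrimeQuotient.
Local Open Scope quotient_scope.
Variables (R : comNzRingType) (X : set R).
Hypothesis X0 : X 0.
Hypothesis X1 : ~ X 1.
Hypothesis XD : forall a u v, X u -> X v -> X (a * u + v).
Hypothesis XM : forall u v, X (u * v) -> X u \/ X v.

Definition prime_pred : R -> bool := fun u => `[< X u >].

Fact prime_pred_closed : idealr_closed prime_pred.
Proof.
split; [exact/asboolP | exact/asboolPn |].
by move=> a u v /asboolP Hu /asboolP Hv; apply/asboolP; exact: XD.
Qed.
HB.instance Definition _ := isIdealr.Build R prime_pred prime_pred_closed.
Fact prime_pred_prime : prime_idealr_closed prime_pred.
Proof. by move=> u v /asboolP /XM [] h; apply/orP; [left|right]; apply/asboolP. Qed.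
HB.instance Definition _ :=
  isPrimeIdealrClosed.Build R prime_pred prime_pred_prime.

Let I : prime_idealr R := prime_pred.
Let Q : comNzRingType := Quotient.quot I.
Let proj : {rmorphism R -> Q} := \pi_Q.

Lemma prime_quotient_field :
  exists (K : fieldType) (f : {rmorphism R -> K}), forall u, f u = 0 <-> X u.
Proof.
have [K [g g_inj]] := domain_embedding (@Quotient.rquot_IdomainAxiom R I).
have projE u : proj u = 0 <-> X u.
  rewrite -(rmorph0 proj); split=> [/eqP|Xu].
    by rewrite -Quotient.idealrBE subr0 => /asboolP.
  by apply/eqP; rewrite -Quotient.idealrBE subr0; apply/asboolP.
exists K, (g \o proj) => u /=; rewrite -projE; split=> [|->]; last exact: rmorph0.
by rewrite -(rmorph0 g) => /g_inj.
Qed.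

End PrimeQuotient.

(** By Zorn there is an ideal maximal among those containing [I] and no power of [s]. It is prime:
    if [u] and [v] lie outside it, adjoining either captures a power of [s], and the product of
    these powers would lie in it if [u * v] did. The field is the fraction field of the quotient. *)
Lemma prime_avoidance (R : comNzRingType) (I : set R) (s : R) :
  I 0 -> (forall a u v, I u -> I v -> I (a * u + v)) -> (forall k, ~ I (s ^+ k)) ->
  exists (K : fieldType) (f : {rmorphism R -> K}),
    (forall u, I u -> f u = 0) /\ f s != 0.
Proof.
move=> I0 ID Is.
pose good (X : set R) := [/\ I `<=` X, forall a u v, X u -> X v -> X (a * u + v)
  & forall k, ~ X (s ^+ k)]%classic.
pose P (X : set R) := X = set0 \/ good X.
have [F FP Ftot|X [PX Xmax]] := @Zorn_bigcup R P.
  have [[Y [FY Yne]]|none] := pselect (exists Y, F Y /\ Y !=set0)%classic; last first.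
    left; apply/seteqP; split=> // u [Y FY Yu]; case: none; exists Y; split=> //.
    by exists u.
  have goodF Z u : F Z -> Z u -> good Z.
    by move=> FZ Zu; case: (FP _ FZ) => // Z0; rewrite Z0 in Zu.
  case: Yne => y Yy; right; split.
  - by move=> u Iu; exists Y => //; case: (goodF Y y FY Yy) => h _ _; apply: h.
  - move=> a u v [Z1 F1 u1] [Z2 F2 v2].
    case: (goodF _ _ F1 u1) => _ D1 _; case: (goodF _ _ F2 v2) => _ D2 _.
    by case: (Ftot _ _ F1 F2) => sub; [exists Z2 | exists Z1] => //;
      [apply: D2 | apply: D1] => //; apply: sub.
  - by move=> k [Z FZ Zs]; case: (goodF _ _ FZ Zs) => _ _ /(_ k).
have goodI : good I by split.
have [IX XD Xs] : good X.
  case: PX => // X0; exfalso; apply: (Xmax I); last by right.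
  by rewrite X0; split=> // /(_ 0 I0).
have X0 := IX 0 I0.
(* Adjoining an element outside of the maximal [X] captures a power of [s]. *)
have adj u : ~ X u -> exists k a v, X v /\ s ^+ k = a * u + v.
  move=> Xu; apply: contrapT => none; pose Y := [set z | exists a v, X v /\ z = a * u + v]%classic.
  apply: (Xmax Y).
    split; first by move=> v Xv; exists 0, v; rewrite mul0r add0r.
    by move=> /(_ u) h; apply: Xu; apply: h; exists 1, 0; rewrite mul1r addr0.
  right; split.
  - by move=> v /IX Xv; exists 0, v; rewrite mul0r add0r.
  - move=> a _ _ [b [v [Xv ->]]] [c [w [Xw ->]]].
    by exists (a * b + c), (a * v + w); split; [exact: XD | ring].
  - by move=> k [a [v [Xv e]]]; apply: none; exists k, a, v.
have XM u v : X (u * v) -> X u \/ X v.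
  move=> Xuv; apply: contrapT => /not_orP [/adj [k [a [u' [Xu' e1]]]] /adj [l [b [v' [Xv' e2]]]]].
  apply: (Xs (k + l)%N); rewrite exprD e1 e2.
  have -> : (a * u + u') * (b * v + v') =
    (a * b) * (u * v) + ((a * u) * v' + ((b * v + v') * u' + 0)) by ring.
  by apply: (XD) => //; apply: (XD) => //; exact: (XD).
have X1 : ~ X 1 := Xs 0%N.
have [K [f Hf]] := prime_quotient_field X0 X1 XD XM.
exists K, f; split=> [u /IX /Hf //|].
by apply/eqP => /Hf; exact: (Xs 1%N).
Qed.

(** * Elimination for systems of quadratic forms *)

Lemma natr_inj_numField (F : numFieldType) : injective (fun n : nat => n%:R : F).
Proof. by move=> m n /eqP; rewrite Num.Theory.eqr_nat => /eqP. Qed.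

Lemma mcoeff_pihomog (F : fieldType) n k (p : {mpoly F[n]}) m :
  (pihomog mdeg k p)@_m = if mdeg m == k then p@_m else 0.
Proof.
rewrite {1}[p]mpolyE (raddf_sum (pihomog mdeg k)) raddf_sum /=.
have -> : (if mdeg m == k then p@_m else 0) =
    \sum_(i <- msupp p) (if mdeg m == k then (p@_i *: 'X_[i])@_m else 0).
  by case: ifP => _; [rewrite {1}[p]mpolyE raddf_sum | rewrite big1].
apply: eq_bigr => i _; rewrite linearZ /= pihomogX !mcoeffZ mcoeffX.
have [->|im] := eqVneq i m; last first.
  by rewrite mulr0 if_same; case: ifP => _; rewrite ?mcoeff0 ?mcoeffX ?(negPf im) mulr0.
by case: ifP => _; rewrite ?mcoeffX ?eqxx // mcoeff0 mulr0.
Qed.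

Lemma meval_dhomog (F : fieldType) n k (p : {mpoly F[n]}) (z : 'I_n -> F) :
  p \is k.-homog ->
  p.@[z] = \sum_(m in [set m : 'X_{1..n < k.+1} | mdeg m == k])
             p@_m * \prod_i z i ^+ m i.
Proof.
move=> hp; rewrite /meval (@mmapE _ _ _ _ _ _ k.+1); last first.
  have [->|p0] := eqVneq p 0; first by rewrite msize0.
  by rewrite -mlead_deg // ltnS (dhomog_mf hp) // mlead_supp.
rewrite [RHS]big_mkcond /=; apply: eq_bigr => m _; rewrite inE.
by case: ifPn => // dm; rewrite (dhomog_nemf_coeff hp dm) mul0r.
Qed.

(** Along the line through [z] the polynomial becomes one in [t], whose coefficients are the values
    at [z] of the homogeneous components; it has infinitely many roots in characteristic 0. *)
Lemma pihomog_vanish (F : numFieldType) n k (p : {mpoly F[n]}) (z : 'I_n -> F) :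
  (forall t, p.@[fun i => t * z i] = 0) -> (pihomog mdeg k p).@[z] = 0.
Proof.
move=> pz; pose g : {poly F} :=
  \sum_(m <- msupp p) (p@_m * \prod_i z i ^+ m i) *: 'X^(mdeg m).
have gE t : g.[t] = 0.
  rewrite -(pz t) horner_sum mevalE; apply: eq_bigr => m _.
  rewrite hornerZ hornerXn -mulrA; congr (_ * _).
  under [RHS]eq_bigr => i _ do rewrite exprMn.
  by rewrite big_split /= mulrC prodrXr mdegE.
have g0 : g = 0.
  apply: (@roots_geq_poly_eq0 _ _ [seq i%:R : F | i <- iota 0 (size g)]).
  - by apply/allP => _ /mapP[i _ ->]; apply/eqP.
  - by rewrite map_inj_uniq ?iota_uniq //; exact: natr_inj_numField.
  - by rewrite size_map size_iota.
have := congr1 (fun q : {poly F} => q`_k) g0; rewrite /= coef0 => <-.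
rewrite pihomogE raddf_sum /= coef_sum big_mkcond /=; apply: eq_bigr => m _.
rewrite coefZ coefXn eq_sym; case: eqP => _; rewrite ?mulr0 // mulr1.
by rewrite mevalZ mevalX.
Qed.

Section Elimination.
Variables (F : numFieldType) (n N : nat) (J : finType).
Variable c : J -> 'I_N -> 'I_N -> {mpoly F[n]}.

Definition quadric (v : 'I_n -> F) (j : J) : {mpoly F[N]} :=
  \sum_s \sum_t (c j s t).@[v] *: ('X_s * 'X_t).

Lemma quadricE v j (K : comNzRingType) (f : {rmorphism {mpoly F[N]} -> K}) :
  f (quadric v j) =
  \sum_s \sum_t f ((c j s t).@[v])%:MP * f 'X_s * f 'X_t.
Proof.
rewrite /quadric rmorph_sum; apply: eq_bigr => s _.
rewrite rmorph_sum; apply: eq_bigr => t _.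
by rewrite -mul_mpolyC !rmorphM mulrA.
Qed.

Lemma meval_quadric v j (z : 'I_N -> F) :
  (quadric v j).@[z] = \sum_s \sum_t (c j s t).@[v] * z s * z t.
Proof.
rewrite quadricE; apply: eq_bigr => s _; apply: eq_bigr => t _.
by rewrite /= mevalC !mevalXU.
Qed.

Variable v0 : 'I_n -> F.
Hypothesis v0_trivial : forall (K : fieldType) (f : {rmorphism F -> K}) (z : 'I_N -> K),
  (forall j, \sum_s \sum_t f (c j s t).@[v0] * z s * z t = 0) ->
  forall s, z s = 0.

Definition quadric_ideal : set {mpoly F[N]} :=
  fun u => exists r : J -> {mpoly F[N]}, u = \sum_j r j * quadric v0 j.

Lemma quadric_idealD a u w :
  quadric_ideal u -> quadric_ideal w -> quadric_ideal (a * u + w).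
Proof.
move=> [r ->] [s ->]; exists (fun j => a * r j + s j).
rewrite mulr_sumr -big_split; apply: eq_bigr => j _.
by rewrite mulrDl mulrA.
Qed.

Lemma quadric_ideal0 : quadric_ideal 0.
Proof. by exists (fun=> 0); rewrite big1 // => j _; rewrite mul0r. Qed.

(** A Nullstellensatz argument: if no power of ['X_i] were in the ideal, prime avoidance would give
    a zero of the system over an extension field with nonzero [i]-th coordinate. *)
Lemma quadric_ideal_var i : exists k, quadric_ideal ('X_i ^+ k).
Proof.
apply: contrapT => none.
have [k Ik|K [f [fI]]] := prime_avoidance quadric_ideal0 quadric_idealD (s := 'X_i).
  by apply: none; exists k.
suff -> : f 'X_i = 0 by rewrite eqxx.
apply: (v0_trivial (f := f \o (@mpolyC N F)) (z := fun s => f 'X_s)) => j /=.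
rewrite -(@quadricE v0 j K f); apply: fI; exists (fun j' => (j' == j)%:R).
rewrite (bigD1 j) //= eqxx mul1r big1 ?addr0 // => j' /negPf ->.
by rewrite mul0r.
Qed.

(** Pigeonhole: a monomial whose degree exceeds the sum of the [k i] contains some ['X_i ^+ k i]. *)
Lemma quadric_ideal_degree :
  exists D, forall m : 'X_{1..N}, mdeg m = D -> quadric_ideal 'X_[m].
Proof.
have [k Hk] := choice quadric_ideal_var.
exists (\sum_i k i).+1 => m mD.
have [i ki] : exists i, (k i <= m i)%N.
  apply: contrapT => /forallNP none; have : (mdeg m <= \sum_i k i)%N.
    rewrite mdegE; apply: leq_sum => i _; apply: ltnW; rewrite ltnNge.
    by apply/negP; exact: none.
  by rewrite mD ltnn.
have -> : 'X_[m] = 'X_[m - U_(i) *+ k i] * ('X_i ^+ k i) + 0 :> {mpoly F[N]}.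
  rewrite addr0 mpolyXn -mpolyXD submK //.
  by apply/mnm_lepP => j; rewrite mulmnE mnm1E; case: eqP => [<-|]; rewrite ?mul1n ?mul0n.
by apply: quadric_idealD => //; exact: quadric_ideal0.
Qed.

Theorem elimination : exists P : {mpoly F[n]}, P.@[v0] != 0 /\
  forall v (z : 'I_N -> F), (forall j, \sum_s \sum_t (c j s t).@[v] * z s * z t = 0) ->
    (exists s, z s != 0) -> P.@[v] = 0.
Proof.
have [D HD] := quadric_ideal_degree.
pose A := [set m : 'X_{1..N < D.+1} | mdeg m == D].
have /choice [r Hr] (m : 'X_{1..N < D.+1}) : exists r : J -> {mpoly F[N]},
    m \in A -> 'X_[m] = \sum_j r j * quadric v0 j.
  have [|_] := boolP (m \in A); last by exists (fun=> 0).
  by rewrite inE => /eqP /HD [r Hr]; exists r.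
(* Row [a] lists the degree [D] coefficients of the combination of quadrics that represents the
   monomial [a] at [v0], with the quadrics now taken at a variable [v]. At [v0] this is the identity
   matrix. *)
pose M : 'M[{mpoly F[n]}]_#|A| := \matrix_(a, b)
  \sum_j \sum_s \sum_t
    (((r (enum_val a) j) * ('X_s * 'X_t))@_(enum_val b : 'X_{1..N < D.+1}))%:MP * c j s t.
have ME v a b : (M a b).@[v] =
    (\sum_j r (enum_val a) j * quadric v j)@_(enum_val b : 'X_{1..N < D.+1}).
  rewrite mxE !raddf_sum; apply: eq_bigr => j _.
  rewrite /= /quadric mulr_sumr !raddf_sum; apply: eq_bigr => s _.
  rewrite /= mulr_sumr !raddf_sum; apply: eq_bigr => t _.
  by rewrite /= mevalM mevalC -scalerAr mcoeffZ mulrC.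
exists (\det M); split=> [|v z qz [s0 z0]].
  rewrite -det_map_mx.
  have -> : map_mx (meval v0) M = 1%:M; last by rewrite det1 oner_eq0.
  apply/matrixP => a b; rewrite [LHS]mxE ME -Hr ?enum_valP // mcoeffX mxE.
  by rewrite (inj_eq val_inj) (inj_eq enum_val_inj).
rewrite -det_map_mx -det_tr; apply/eqP/det0P.
(* The vector of degree [D] monomials of [z] is in the kernel; it is nonzero because of its entry at
   ['X_s0 ^+ D]. *)
exists (\row_b \prod_i z i ^+ (enum_val b : 'X_{1..N < D.+1}) i).
  have mD : (mdeg (U_(s0) *+ D)%MM < D.+1)%N by rewrite mdegMn mdeg1 mul1n.
  have mA : BMultinom mD \in A by rewrite inE /= mdegMn mdeg1 mul1n.
  apply/eqP => /rowP /(_ (enum_rank_in mA (BMultinom mD))).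
  rewrite !mxE enum_rankK_in // (bigD1 s0) //= big1 => [|i i0].
    by apply/eqP; rewrite mulr1 mulmnE mnm1E eqxx mul1n expf_neq0.
  by rewrite mulmnE mnm1E eq_sym (negPf i0).
apply/rowP => a; rewrite !mxE.
pose G := \sum_j r (enum_val a) j * quadric v j.
(* The multipliers [r] need not be homogeneous, so only the degree [D] part of [G] matches the row;
   it vanishes at [z] since [G] vanishes on the whole line through [z]. *)
have G0 : (pihomog mdeg D G).@[z] = 0.
  apply: pihomog_vanish => t; rewrite raddf_sum big1 // => j _.
  rewrite /= mevalM meval_quadric.
  have -> : \sum_s \sum_t0 (c j s t0).@[v] * (t * z s) * (t * z t0) =
      t ^+ 2 * \sum_s \sum_t0 (c j s t0).@[v] * z s * z t0.
    rewrite mulr_sumr; apply: eq_bigr => s _; rewrite mulr_sumr.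
    by apply: eq_bigr => t' _; ring.
  by rewrite qz !mulr0.
transitivity ((pihomog mdeg D G).@[z]); last exact: G0.
rewrite (meval_dhomog _ (pihomogP _ _ _)) -/A [RHS]big_enum_val /=.
apply: eq_bigr => b _; have -> : (map_mx (meval v) M)^T b a = (M a b).@[v].
  by rewrite [LHS]mxE [LHS]mxE.
rewrite [X in X * _]mxE ME mcoeff_pihomog mulrC.
by have := enum_valP b; rewrite inE => ->.
Qed.

End Elimination.

(** * The invariance equation of a quadratic map *)

Section InvarianceForm.
Variables (A : comNzRingType) (d : nat).
Variables (v : 'I_3 -> 'I_6 -> A) (x y : A).

Definition coef_index : finType := ('I_2 * 'I_d.+1 * 'I_d.+1)%type.

Definition quad_expx (k : 'I_6) : nat := tnth quad_monomials k (1 : 'I_3).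
Definition quad_expy (k : 'I_6) : nat := tnth quad_monomials k (2 : 'I_3).

(** The quadratic form with coefficients [v i], evaluated at [(1, x, y)]. The ring [A] is arbitrary,
    so that generic and specialized coefficients are treated alike. *)
Definition quad i : A := \sum_k v i k * x ^+ quad_expx k * y ^+ quad_expy k.
Definition quad_dx i : A :=
  \sum_k v i k * (x ^+ (quad_expx k).-1 *+ quad_expx k) * y ^+ quad_expy k.
Definition quad_dy i : A :=
  \sum_k v i k * x ^+ quad_expx k * (y ^+ (quad_expy k).-1 *+ quad_expy k).

(* Numerators of the partial derivatives of [quad i / quad 0]. *)
Definition quotient_dx (i : 'I_2) : A :=
  quad 0 * quad_dx (lift ord0 i) - quad (lift ord0 i) * quad_dx 0.
Definition quotient_dy (i : 'I_2) : A :=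
  quad 0 * quad_dy (lift ord0 i) - quad (lift ord0 i) * quad_dy 0.

Definition form_coef (w : coef_index -> A) (s : 'I_2) : A :=
  \sum_(i < d.+1) \sum_(j < d.+1) w (s, i, j) * x ^+ i * y ^+ j.

(* [form_coef w s] composed with the map [(quad 1 / quad 0, quad 2 / quad 0)],
   times [quad 0 ^+ (2 * d)]. *)
Definition pulled_coef (w : coef_index -> A) (s : 'I_2) : A :=
  \sum_(i < d.+1) \sum_(j < d.+1)
    w (s, i, j) * (quad 0 ^+ (d - i + (d - j)) * quad 1 ^+ i * quad 2 ^+ j).

(** The coefficient of [dx /\ dy] in the pullback wedge the form, multiplied by
    [quad 0 ^+ (2 * d + 2)] to clear denominators. *)
Definition invariance_form (w : coef_index -> A) : A :=
  (\sum_s pulled_coef w s * quotient_dx s) * form_coef w 1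
  - (\sum_s pulled_coef w s * quotient_dy s) * form_coef w 0.

(** In the wedge product the [dx] part of the pullback meets the second coefficient of the form and
    the [dy] part, with a sign, the first; hence the test on [i']. *)
Definition invariance_coef (s t : coef_index) : A :=
  let: (i, j, k) := s in let: (i', j', k') := t in
  quad 0 ^+ (d - j + (d - k)) * quad 1 ^+ j * quad 2 ^+ k *
  (if i' == 1 then quotient_dx i else - quotient_dy i) * (x ^+ j' * y ^+ k').

Lemma sum_coef_index (F : coef_index -> A) :
  \sum_s F s = \sum_(i < 2) \sum_(j < d.+1) \sum_(k < d.+1) F (i, j, k).
Proof.
transitivity (\sum_(p : 'I_2 * 'I_d.+1) \sum_(k < d.+1) F (p, k)).
  by rewrite [RHS]pair_bigA; apply: eq_bigr => -[p k].
by rewrite [RHS]pair_bigA; apply: eq_bigr => -[i j].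
Qed.

Lemma invariance_formE w :
  invariance_form w = \sum_s \sum_t w s * w t * invariance_coef s t.
Proof.
have inner s : \sum_t w s * w t * invariance_coef s t =
  w s * (quad 0 ^+ (d - s.1.2 + (d - s.2)) * quad 1 ^+ s.1.2 * quad 2 ^+ s.2) *
  (quotient_dx s.1.1 * form_coef w 1 - quotient_dy s.1.1 * form_coef w 0).
  case: s => -[i j] k; rewrite sum_coef_index big_ord_recl [X in _ + X]big_ord_recl big_ord0 addr0 /=.
  have -> : lift ord0 ord0 = 1 :> 'I_2 by apply: val_inj.
  set q := quad 0 ^+ _ * _ * _.
  have sumE (c : A) (r : 'I_2) :
      \sum_(j' < d.+1) \sum_(k' < d.+1)
        w (i, j, k) * w (r, j', k') * (q * c * (x ^+ j' * y ^+ k')) =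
      w (i, j, k) * q * (c * form_coef w r).
    rewrite /form_coef !mulr_sumr; apply: eq_bigr => j' _.
    by rewrite !mulr_sumr; apply: eq_bigr => k' _; ring.
  by rewrite !sumE [LHS]addrC [RHS]mulrBr mulNr mulrN.
under [RHS]eq_bigr => s _ do rewrite inner.
rewrite sum_coef_index /invariance_form !mulr_suml -sumrB.
apply: eq_bigr => i _; rewrite -!mulrA -mulrBr mulr_suml.
apply: eq_bigr => j _; rewrite mulr_suml; apply: eq_bigr => k _.
by rewrite mulrA.
Qed.

End InvarianceForm.

(** * Compatibility of the invariance equation with ring morphisms *)

Section Naturality.
Variables (A B : comNzRingType) (f : {rmorphism A -> B}) (d : nat).
Variables (v : 'I_3 -> 'I_6 -> A) (x y : A).

Let fv i k := f (v i k).

Lemma rmorph_quad i : f (quad v x y i) = quad fv (f x) (f y) i.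
Proof.
by rewrite /quad rmorph_sum; apply: eq_bigr => k _; rewrite !rmorphM !rmorphXn.
Qed.

Lemma rmorph_quad_dx i : f (quad_dx v x y i) = quad_dx fv (f x) (f y) i.
Proof.
rewrite /quad_dx rmorph_sum; apply: eq_bigr => k _.
by rewrite !rmorphM rmorphMn !rmorphXn.
Qed.

Lemma rmorph_quad_dy i : f (quad_dy v x y i) = quad_dy fv (f x) (f y) i.
Proof.
rewrite /quad_dy rmorph_sum; apply: eq_bigr => k _.
by rewrite !rmorphM rmorphMn !rmorphXn.
Qed.

Lemma rmorph_invariance_coef (s t : coef_index d) :
  f (invariance_coef v x y s t) = invariance_coef fv (f x) (f y) s t.
Proof.
case: s t => -[i j] k [[i' j'] k']; rewrite /invariance_coef.
by case: ifP => _; rewrite !(rmorphM, rmorphXn, rmorphN, rmorphB, rmorph_quad,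
  rmorph_quad_dx, rmorph_quad_dy).
Qed.

Lemma rmorph_invariance_form (w : coef_index d -> A) :
  f (invariance_form v x y w) = invariance_form fv (f x) (f y) (fun s => f (w s)).
Proof.
rewrite !invariance_formE rmorph_sum; apply: eq_bigr => s _.
rewrite rmorph_sum; apply: eq_bigr => t _.
by rewrite !rmorphM rmorph_invariance_coef.
Qed.

End Naturality.

Lemma quad_expE k : quad_expx k = nth 0%N [:: 0; 1; 0; 2; 1; 0]%N k /\
  quad_expy k = nth 0%N [:: 0; 0; 1; 0; 1; 2]%N k.
Proof.
rewrite /quad_expx /quad_expy.
by case: k => -[|[|[|[|[|[|//]]]]]] ? /=;
  rewrite !(tnth_nth 0%MM) /= /mon2 !mnmDE !mnm1E.
Qed.

(* The map [x0^2 : x0 x2 : x1 x2 + x0^2], that is (x, y) |-> (y, x y + 1). *)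
Definition special_coord (i : 'I_3) (k : 'I_6) : bool :=
  (i : nat, k : nat) \in [:: (0, 0); (1, 2); (2, 4); (2, 0)]%N.

Section SpecialForm.
Variables (A : comNzRingType) (x y : A).
Let v i k : A := (special_coord i k)%:R.

Let expand (F : 'I_6 -> nat -> nat -> A) :
  \sum_k F k (quad_expx k) (quad_expy k) =
  F (inord 0) 0%N 0%N + (F (inord 1) 1%N 0%N + (F (inord 2) 0%N 1%N +
  (F (inord 3) 2%N 0%N + (F (inord 4) 1%N 1%N + F (inord 5) 0%N 2%N)))).
Proof.
rewrite !big_ord_recl big_ord0 addr0 !(quad_expE _).1 !(quad_expE _).2 /=.
by do !congr (_ + _); congr F; apply: val_inj; rewrite /= inordK.
Qed.

Let special_coordE i k : (k < 6)%N ->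
  v i (inord k) = ((i : nat, k) \in [:: (0, 0); (1, 2); (2, 4); (2, 0)]%N)%:R.
Proof. by move=> k6; rewrite /v /special_coord inordK. Qed.

Lemma special_quad : [/\ quad v x y 0 = 1, quad v x y 1 = y & quad v x y 2 = x * y + 1].
Proof.
rewrite /quad; split; rewrite (expand (fun k a b => v _ k * x ^+ a * y ^+ b));
  rewrite !special_coordE // /=; ring.
Qed.

Lemma special_quad_dx :
  [/\ quad_dx v x y 0 = 0, quad_dx v x y 1 = 0 & quad_dx v x y 2 = y].
Proof.
rewrite /quad_dx; split;
  rewrite (expand (fun k a b => v _ k * (x ^+ a.-1 *+ a) * y ^+ b));
  rewrite !special_coordE // /=; ring.
Qed.

Lemma special_quad_dy :
  [/\ quad_dy v x y 0 = 0, quad_dy v x y 1 = 1 & quad_dy v x y 2 = x].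
Proof.
rewrite /quad_dy; split;
  rewrite (expand (fun k a b => v _ k * x ^+ a * (y ^+ b.-1 *+ b)));
  rewrite !special_coordE // /=; ring.
Qed.

End SpecialForm.

(** For the special coefficients [quad 0] is 1, so no denominator was cleared and the equation is
    [invariant_pair] for the two polynomial coefficients of the form. *)
Lemma special_no_invariant (K : fieldType) (K0 : [pchar K] =i pred0) d
    (w : coef_index d -> K) :
  invariance_form (fun i k => (special_coord i k)%:R) ('X%:P) 'X
    (fun s => (w s)%:P%:P) = 0 :> {poly {poly K}} ->
  forall s, w s = 0.
Proof.
set v := fun _ _ => _; set W := fun s => _.
have [q0 q1 q2] := special_quad ('X%:P : {poly {poly K}}) 'X.
have [x0 x1 x2] := special_quad_dx ('X%:P : {poly {poly K}}) 'X.
have [y0 y1 y2] := special_quad_dy ('X%:P : {poly {poly K}}) 'X.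
rewrite -/v in q0 q1 q2 x0 x1 x2 y0 y1 y2.
pose p s := form_coef ('X%:P : {poly {poly K}}) 'X W s.
have pulledE s : pulled_coef v 'X%:P 'X W s = special_pullback (p s).
  rewrite /p /form_coef /pulled_coef rmorph_sum; apply: eq_bigr => i _.
  rewrite rmorph_sum; apply: eq_bigr => j _.
  rewrite /= !special_pullbackM !special_pullback_exp special_pullbackC special_pullbackX special_pullbackY.
  by rewrite q0 q1 q2 expr1n mul1r mulrA.
have l1 : lift ord0 (0 : 'I_2) = 1 by apply: val_inj.
have l2 : lift ord0 (1 : 'I_2) = 2 by apply: val_inj.
rewrite /invariance_form !big_ord_recl !big_ord0 !addr0 /= !pulledE.
have -> : lift ord0 (ord0 : 'I_1) = (1 : 'I_2) by apply: val_inj.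
rewrite -[ord0]/(0 : 'I_2) /quotient_dx /quotient_dy l1 l2.
rewrite q0 q1 q2 x0 x1 x2 y0 y1 y2 -/(p 0) -/(p 1) => E.
have inv : invariant_pair (p 0, p 1).
  rewrite /invariant_pair /=; apply/eqP; rewrite -subr_eq0 -E; apply/eqP; ring.
have [p0 p1] : p 0 = 0 /\ p 1 = 0.
  by have [] := invariant_pair_eq0 K0 inv.
have ps s : p s = 0.
  have [->|->] : s = 0 \/ s = 1 by case: s => -[|[|//]] lt; [left|right]; apply: val_inj.
    exact: p0.
  exact: p1.
case=> -[s i] j; have := congr1 (fun q : {poly {poly K}} => q`_j`_i) (ps s).
rewrite /p /form_coef /= !coef0 !coef_sum (bigD1 i) //= !coef_sum (bigD1 j) //=.
have term i' j' : (W (s, i', j') * ('X%:P : {poly {poly K}}) ^+ i' * 'X^j')`_j`_i =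
    if (i' == i) && (j' == j) then w (s, i, j) else 0.
  rewrite /W -polyC_exp -polyCM coefCM coefXn.
  case: (eqVneq j' j) => [->|jj]; last first.
    by rewrite eq_sym (negPf (jj : (j' : nat) != j)) mulr0 coef0 andbF.
  rewrite eqxx mulr1 coefCM coefXn andbT.
  case: (eqVneq i' i) => [->|ii]; first by rewrite eqxx mulr1.
  by rewrite eq_sym (negPf (ii : (i' : nat) != i)) mulr0.
rewrite term !eqxx big1 => [|j' jj]; last by rewrite term (negPf jj) andbF.
rewrite addr0 big1 ?addr0 // => i' ii; rewrite !coef_sum big1 // => j' _.
by rewrite term (negPf ii).
Qed.

(** * Elimination of the coefficients of the invariant form *)

Section InvarianceLocus.
Variables (F : numFieldType) (d : nat).
Local Notation V := {mpoly F[3 * 6]}.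
Local Notation W := (coef_index d).

Let generic_coord i k : {poly {poly V}} := ('X_(mxvec_index i k))%:P%:P.
Let generic_coef (s t : 'I_#|W|) : {poly {poly V}} :=
  invariance_coef generic_coord 'X%:P 'X (enum_val s) (enum_val t).

(** Elimination needs a finite system; the bound makes ['I_m * 'I_m] index all its equations. *)
Lemma generic_coef_bound : exists m, forall s t k l,
  (m <= k)%N || (m <= l)%N -> (generic_coef s t)`_k`_l = 0.
Proof.
exists (\max_s \max_t maxn (size (generic_coef s t)) (sizeY (generic_coef s t))).
move=> s t k l; set m := \max_s _ => mkl.
have le_m : (maxn (size (generic_coef s t)) (sizeY (generic_coef s t)) <= m)%N.
  apply: leq_trans _ (leq_bigmax s); exact: (leq_bigmax t).
case/orP: mkl => [mk|ml].
  have -> : (generic_coef s t)`_k = 0; last by rewrite coef0.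
  apply: nth_default; apply: leq_trans mk; apply: leq_trans _ le_m.
  exact: leq_maxl.
rewrite nth_default //; apply: leq_trans (max_size_coefXY _ _) _.
by apply: leq_trans ml; apply: leq_trans _ le_m; exact: leq_maxr.
Qed.

Lemma sum_generic_coef (K : comNzRingType) (phi : {rmorphism V -> K}) (z : 'I_#|W| -> K) k l :
  \sum_s \sum_t phi (generic_coef s t)`_k`_l * z s * z t =
  (invariance_form (fun i k => (phi 'X_(mxvec_index i k))%:P%:P) 'X%:P 'X
     (fun s : W => (z (enum_rank s))%:P%:P))`_k`_l.
Proof.
pose ev : {rmorphism {poly {poly V}} -> {poly {poly K}}} := map_poly (map_poly phi).
have evE s t : ev (generic_coef s t) =
  invariance_coef (fun i k => (phi 'X_(mxvec_index i k))%:P%:P) 'X%:P 'X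
    (enum_val s) (enum_val t).
  have vE : (fun i k => ev (generic_coord i k)) =
      (fun i k => (phi 'X_(mxvec_index i k))%:P%:P).
    apply/funext => i; apply/funext => j.
    by rewrite /ev /generic_coord /= map_polyC /= map_polyC.
  by rewrite rmorph_invariance_coef vE /ev /= map_polyC /= map_polyX map_polyX.
have coefE s t : phi (generic_coef s t)`_k`_l = (ev (generic_coef s t))`_k`_l.
  by rewrite /ev /= coef_map /= coef_map.
rewrite invariance_formE !coef_sum (reindex (@enum_rank W)); last first.
  by apply: onW_bij; exact: enum_rank_bij.
apply: eq_bigr => s _; rewrite !coef_sum (reindex (@enum_rank W)); last first.
  by apply: onW_bij; exact: enum_rank_bij.
apply: eq_bigr => t _; rewrite coefE evE !enum_rankK -!polyCM !coefCM.
by rewrite -mulrA mulrC.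
Qed.

Definition special_point (a : 'I_(3 * 6)) : F :=
  mxvec (\matrix_(i, k) (special_coord i k)%:R) ord0 a.

(** The quadrics are the coefficients in [x] and [y] of the invariance form with indeterminate map
    coefficients. Triviality at the special point holds over every extension of [F], as these all
    have characteristic 0. *)
Theorem invariance_locus : exists P : V, P.@[special_point] != 0 /\
  forall (v : 'I_(3 * 6) -> F) (w : W -> F), (exists s, w s != 0) ->
    invariance_form (fun i k => (v (mxvec_index i k))%:MP) 'X_0 'X_1
      (fun s => (w s)%:MP) = 0 :> {mpoly F[2]} ->
    P.@[v] = 0.
Proof.
have [m Hm] := generic_coef_bound.
pose c (j : 'I_m * 'I_m) s t := (generic_coef s t)`_(j.1)`_(j.2).
have [|P [P0 HP]] := @elimination F (3 * 6) #|W| ('I_m * 'I_m)%type c special_point.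
  move=> K f z zc s; pose phi : {rmorphism V -> K} := f \o meval special_point.
  have pE : (fun i k => (phi 'X_(mxvec_index i k))%:P%:P) =
      (fun i k => (special_coord i k)%:R) :> (_ -> _ -> {poly {poly K}}).
    apply/funext => i; apply/funext => k; rewrite /phi /= mevalXU /special_point.
    by rewrite mxvecE mxE !rmorph_nat.
  have K0 : [pchar K] =i pred0.
    by move=> p; rewrite (fmorph_pchar f) Num.Theory.pchar_num.
  rewrite -[s]enum_valK; apply: (special_no_invariant K0 (w := fun s => z (enum_rank s))).
  rewrite -pE; apply/polyP => k; apply/polyP => l; rewrite !coef0 -sum_generic_coef.
  have [km|mk] := ltnP k m; last first.
    rewrite big1 // => s1 _; rewrite big1 // => t1 _.
    by rewrite Hm ?mk // rmorph0 !mul0r.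
  have [lm|ml] := ltnP l m; last first.
    rewrite big1 // => s1 _; rewrite big1 // => t1 _.
    by rewrite Hm ?ml ?orbT // rmorph0 !mul0r.
  exact: (zc (Ordinal km, Ordinal lm)).
exists P; split=> // v w [s ws] E.
apply: (HP v (fun a => w (enum_val a))); last first.
  by exists (enum_rank s); rewrite enum_rankK.
(* The given equation is in [{mpoly F[2]}], the system in [{poly {poly F}}]; [h] identifies the
   variables. *)
pose h : {rmorphism {mpoly F[2]} -> {poly {poly F}}} :=
  mmap (polyC \o polyC) (fun i : 'I_2 => if i == 0 then 'X%:P else 'X).
move=> j; rewrite (sum_generic_coef (meval v)).
have := congr1 h E; rewrite rmorph_invariance_form rmorph0 /h /= !mmapX !mmap1U /=.
have -> : (fun i k => ('X_(mxvec_index i k)).@[v]%:P%:P) =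
  (fun i k => mmap (polyC \o polyC) (fun i : 'I_2 => if i == 0 then 'X%:P else 'X)
     (v (mxvec_index i k))%:MP).
  by apply/funext => i; apply/funext => k; rewrite mevalXU mmapC.
have -> : (fun s : W => (w (enum_val (enum_rank s)))%:P%:P) =
  (fun s => mmap (polyC \o polyC) (fun i : 'I_2 => if i == 0 then 'X%:P else 'X)
     (w s)%:MP).
  by apply/funext => s'; rewrite enum_rankK mmapC.
by move=> ->; rewrite !coef0.
Qed.

End InvarianceLocus.

(** * Rational forms *)

Lemma sum_ord2 (V : zmodType) (f : 'I_2 -> V) : \sum_i f i = f 0 + f 1.
Proof.
by rewrite big_ord_recl big_ord1; congr (f _ + f _); apply: val_inj.
Qed.

Lemma invariance_form2 (A : comNzRingType) d (v : 'I_3 -> 'I_6 -> A) (x y : A)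
    (w : coef_index d -> A) :
  invariance_form v x y w =
  (pulled_coef v x y w 0 * quotient_dx v x y 0 + pulled_coef v x y w 1 * quotient_dx v x y 1)
    * form_coef x y w 1
  - (pulled_coef v x y w 0 * quotient_dy v x y 0 + pulled_coef v x y w 1 * quotient_dy v x y 1)
    * form_coef x y w 0.
Proof. by rewrite /invariance_form; congr (_ * _ - _ * _); exact: sum_ord2. Qed.

Section FractionAlgebra.
Variables (F : numFieldType) (K : fieldType).
Local Notation R := {mpoly F[2]}.
Variable t : {rmorphism R -> K}.
Hypothesis t_inj : injective t.

Lemma embedding_eq0 (p : R) : (t p == 0) = (p == 0).
Proof. by rewrite -(rmorph0 t) (inj_eq t_inj). Qed.

(** Differentiating [n * d' = n' * d] shows that the quotient rule does not depend on the
    representative. *)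
Lemma quotient_rule_ext j (n d n' d' : R) : d != 0 -> d' != 0 ->
  t n / t d = t n' / t d' ->
  t (n'^`M(j) * d' - n' * d'^`M(j)) / t (d' ^+ 2) =
  t (n^`M(j) * d - n * d^`M(j)) / t (d ^+ 2).
Proof.
move=> d0 d'0 /eqP; rewrite eqr_div ?embedding_eq0 // -!rmorphM => /eqP /t_inj ee.
have de := congr1 (mderiv j) ee; rewrite !mderivM in de.
apply/eqP; rewrite eqr_div ?embedding_eq0 ?expf_neq0 // -!rmorphM; apply/eqP; congr (t _).
have -> : (n'^`M(j) * d' - n' * d'^`M(j)) * d ^+ 2 =
   d' * d * (n'^`M(j) * d + n' * d^`M(j)) - (n' * d) * (d * d'^`M(j) + d' * d^`M(j)) by ring.
by rewrite -de -ee; ring.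
Qed.

Definition affine_mon (i j : nat) : 'X_{1..2} := (U_(0%R) *+ i + U_(1%R) *+ j)%MM.

Lemma affine_monE (m : 'X_{1..2}) : m = affine_mon (m 0) (m 1).
Proof.
apply/mnmP => k; rewrite mnmDE !mulmnE !mnm1E.
by case: k => -[|[|//]] lt; rewrite ?(mul0n, mul1n, addn0, add0n);
  congr (m _); apply: val_inj.
Qed.

Lemma affine_mon_inj i j i' j' : affine_mon i j = affine_mon i' j' -> i = i' /\ j = j'.
Proof.
move=> e; split; [have := congr1 (fun m : 'X_{1..2} => m 0) e
  | have := congr1 (fun m : 'X_{1..2} => m 1) e];
  by rewrite !mnmDE !mulmnE !mnm1E /= ?(muln0, muln1, mul0n, mul1n, addn0, add0n).
Qed.

Lemma affine_expand d (p : R) : (msize p <= d.+1)%N ->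
  p = \sum_(i < d.+1) \sum_(j < d.+1) (p@_(affine_mon i j))%:MP * 'X_0 ^+ i * 'X_1 ^+ j.
Proof.
move=> pd; apply/mpolyP => m; rewrite raddf_sum /=.
have term (i j : nat) : ((p@_(affine_mon i j))%:MP * 'X_0 ^+ i * 'X_1 ^+ j)@_m =
    if affine_mon i j == m then p@_m else 0.
  rewrite -mulrA !mpolyXn -mpolyXD mcoeffCM mcoeffX -/(affine_mon i j).
  by case: eqP => [->|]; rewrite ?mulr1 ?mulr0.
have [dm|md] := ltnP (mdeg m) d.+1; last first.
  have pm0 : p@_m = 0 by apply: memN_msupp_eq0; apply: msize_mdeg_ge; apply: leq_trans md.
  rewrite pm0 big1 // => i _; rewrite raddf_sum big1 // => j _.
  by rewrite /= term pm0 if_same.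
have m0 : (m 0%R < d.+1)%N by apply: leq_ltn_trans dm; rewrite mdegE (bigD1 0) //= leq_addr.
have m1 : (m 1%R < d.+1)%N by apply: leq_ltn_trans dm; rewrite mdegE (bigD1 1) //= leq_addr.
rewrite (bigD1 (Ordinal m0)) //= raddf_sum (bigD1 (Ordinal m1)) //=.
rewrite term -affine_monE eqxx big1 => [|j jm]; last first.
  rewrite term; case: eqP => // e; move: jm; rewrite [m]affine_monE in e.
  by have [_ ej] := affine_mon_inj e; case/negP; apply/eqP; apply: val_inj.
rewrite addr0 big1 ?addr0 // => i im; rewrite raddf_sum big1 // => j _.
rewrite /= term; case: eqP => // e; move: im; rewrite [m]affine_monE in e.
by have [ei _] := affine_mon_inj e; case/negP; apply/eqP; apply: val_inj.
Qed.

Lemma mderivXn (p : R) k j : (p ^+ k)^`M(j) = p^`M(j) * (p ^+ k.-1 *+ k).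
Proof.
elim: k => [|k IHk]; first by rewrite expr0 -mpolyC1 mderivC mulr0n mulr0.
rewrite exprS mderivM IHk; case: k {IHk} => [|k]; first by rewrite !expr0 mulr0n !mulr0 addr0 mulr1n.
by rewrite /= [in RHS]mulrS [RHS]mulrDr; congr (_ + _); rewrite mulrCA [p * _]mulrnAr -exprS.
Qed.

Lemma mderivXU (i j : 'I_2) : ('X_i : R)^`M(j) = (i == j)%:R.
Proof.
rewrite mderivX mnm1E; case: eqP => [->|_]; last by rewrite scale0r.
have -> : (U_(j) - U_(j) = 0 :> 'X_{1..2})%MM by apply/mnmP => k; rewrite mnmBE subnn mnm0E.
by rewrite scale1r mpolyX0.
Qed.

Variable v : 'I_3 -> 'I_6 -> F.
Let cv i k : R := (v i k)%:MP.
Local Notation q := (quad cv 'X_0 'X_1).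

Lemma mderiv_quad_dx i : (q i)^`M(0) = quad_dx cv 'X_0 'X_1 i.
Proof.
rewrite /quad /quad_dx raddf_sum; apply: eq_bigr => k _.
by rewrite /= !mderivM mderivC !mderivXn !mderivXU /= !(mul0r, mul1r, mulr0, add0r, addr0).
Qed.

Lemma mderiv_quad_dy i : (q i)^`M(1) = quad_dy cv 'X_0 'X_1 i.
Proof.
rewrite /quad /quad_dy raddf_sum; apply: eq_bigr => k _.
by rewrite /= !mderivM mderivC !mderivXn !mderivXU /= !(mul0r, mul1r, mulr0, add0r, addr0).
Qed.

(* The substitution [p |-> p (q 1 / q 0, q 2 / q 0)]. *)
Variable Phi : {rmorphism R -> K}.
Hypothesis q0 : q 0 != 0.
Hypothesis PhiC : forall c, Phi c%:MP = t c%:MP.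
Hypothesis PhiX : forall i, Phi 'X_i = t (q (lift ord0 i)) / t (q 0).
Hypothesis dominant : forall p : R, p != 0 -> Phi p != 0.

Lemma clear_denominators (Q a b c : K) m i j : Q != 0 ->
  c * (Q ^+ m * a ^+ i * b ^+ j) = Q ^+ (m + (i + j)) * (c * (a / Q) ^+ i * (b / Q) ^+ j).
Proof.
move=> Q0; have Qi : Q ^+ i != 0 by rewrite expf_neq0.
have Qj : Q ^+ j != 0 by rewrite expf_neq0.
rewrite !expr_div_n !exprD; move: (Q ^+ m) (Q ^+ i) (Q ^+ j) (a ^+ i) (b ^+ j) Qi Qj
  => u v1 v2 a1 b1 Qi Qj.
by field; rewrite Qi Qj.
Qed.

Lemma pulled_coefE d (w : coef_index d -> F) s :
  t (pulled_coef cv 'X_0 'X_1 (fun s => (w s)%:MP) s) =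
  t (q 0) ^+ (d + d) * Phi (form_coef 'X_0 'X_1 (fun s => (w s)%:MP) s).
Proof.
set Q := t (q 0); rewrite /pulled_coef /form_coef !rmorph_sum mulr_sumr.
apply: eq_bigr => i _; rewrite !rmorph_sum mulr_sumr; apply: eq_bigr => j _.
rewrite !rmorphM !rmorphXn PhiC !PhiX.
have id : (i <= d)%N by rewrite -ltnS.
have jd : (j <= d)%N by rewrite -ltnS.
have -> : (d + d = (d - i + (d - j)) + (i + j))%N by lia.
have -> : lift ord0 (0 : 'I_2) = 1 by apply: val_inj.
have -> : lift ord0 (1 : 'I_2) = 2 by apply: val_inj.
have Q0 : t (q 0) != 0 by rewrite embedding_eq0.
by rewrite /Q; exact: clear_denominators.
Qed.

Lemma wedge_clear_denominators (n0 n1 e0 e1 m0 m1 d0 d1 x0 x1 y0 y1 Q Qd : K) :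
  e0 != 0 -> e1 != 0 -> d0 != 0 -> d1 != 0 -> Q != 0 ->
  (n0 / e0 * (x0 / Q ^+ 2) + n1 / e1 * (x1 / Q ^+ 2)) * (m1 / d1)
  - (n0 / e0 * (y0 / Q ^+ 2) + n1 / e1 * (y1 / Q ^+ 2)) * (m0 / d0) = 0 ->
  (Qd * (n0 * e1) * x0 + Qd * (n1 * e0) * x1) * (m1 * d0)
  - (Qd * (n0 * e1) * y0 + Qd * (n1 * e0) * y1) * (m0 * d1) = 0.
Proof.
move=> e00 e10 d00 d10 Q0 E.
rewrite -[RHS](mulr0 (Qd * Q ^+ 2 * e0 * e1 * d0 * d1)) -E; field.
by rewrite e00 e10 d00 d10 Q0.
Qed.

Lemma invariance_form_of_fractions (n e : 'I_2 -> R) :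
  (forall i, e i != 0) -> (n 0 != 0) || (n 1 != 0) ->
  (Phi (n 0) / Phi (e 0) * (t (quotient_dx cv 'X_0 'X_1 0) / t (q 0) ^+ 2)
   + Phi (n 1) / Phi (e 1) * (t (quotient_dx cv 'X_0 'X_1 1) / t (q 0) ^+ 2))
    * (t (n 1) / t (e 1))
  - (Phi (n 0) / Phi (e 0) * (t (quotient_dy cv 'X_0 'X_1 0) / t (q 0) ^+ 2)
   + Phi (n 1) / Phi (e 1) * (t (quotient_dy cv 'X_0 'X_1 1) / t (q 0) ^+ 2))
    * (t (n 0) / t (e 0)) = 0 ->
  exists d (z : coef_index d -> F), (exists s, z s != 0) /\
    invariance_form cv 'X_0 'X_1 (fun s => (z s)%:MP) = 0.
Proof.
move=> e0 n0 inv.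
(* Multiplying the form by [e 0 * e 1] makes its coefficients polynomial without changing the
   foliation. *)
pose a := n 0 * e 1; pose b := n 1 * e 0.
have ab0 : (a != 0) || (b != 0) by rewrite !mulf_eq0 !(negPf (e0 _)) !orbF.
pose d := maxn (msize a) (msize b).
pose z (s : coef_index d) : F := (if s.1.1 == 0 then a else b)@_(affine_mon s.1.2 s.2).
pose Z s := (z s)%:MP : R.
have fa : form_coef 'X_0 'X_1 Z 0 = a.
  by rewrite [RHS](@affine_expand d) // ltnW // ltnS leq_maxl.
have fb : form_coef 'X_0 'X_1 Z 1 = b.
  by rewrite [RHS](@affine_expand d) // ltnW // ltnS leq_maxr.
exists d, z; split.
  apply: contrapT => /forallNP z0; have {}z0 s : z s = 0.
    by have /negP := z0 s; rewrite negbK => /eqP.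
  have Z0 r : form_coef 'X_0 'X_1 Z r = 0.
    by rewrite /form_coef big1 // => i _; rewrite big1 // => j _; rewrite /Z z0 mpolyC0 !mul0r.
  by move: ab0; rewrite -fa -fb !Z0 eqxx.
apply: t_inj; rewrite rmorph0 -/Z.
rewrite invariance_form2 fa fb.
have p0 := pulled_coefE z 0.
have p1 := pulled_coefE z 1.
rewrite -/Z fa in p0.
rewrite -/Z fb in p1.
move: p0 p1 inv.
move: (pulled_coef _ _ _ _ _) (pulled_coef _ _ _ _ _) => P0 P1 p0 p1.
move: (quotient_dx _ _ _ 0) (quotient_dx _ _ _ 1) (quotient_dy _ _ _ 0).
move: (quotient_dy _ _ _ 1) => y1 x0 x1 y0 inv.
rewrite rmorphB !rmorphM !rmorphD !rmorphM p0 p1 /a /b !rmorphM.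
apply: (wedge_clear_denominators _ _ _ _ _ _ inv); rewrite ?embedding_eq0 //;
  exact: dominant.
Qed.

End FractionAlgebra.

(** * Representatives in the function field *)

Section FunctionField.
Variable F : numFieldType.
Local Notation R := {mpoly F[2]}.
Local Notation L := (funfield F).
Local Notation tofrac := (@FracField.tofrac {mpoly F[2]}).

Lemma frac_reprE (r : L) : r = tofrac \n_(repr r) / tofrac \d_(repr r).
Proof.
have d0 : tofrac \d_(repr r) != 0 by rewrite tofrac_eq0 denom_ratioP.
apply: (mulIf d0); rewrite divfK //.
rewrite -{1}[r]reprK -[_ * _]/(FracField.mul _ _) !piE.
apply/eqmodP; rewrite /= FracField.equivfE /FracField.mulf.
by rewrite !numden_Ratio ?mulf_neq0 ?denom_ratioP ?oner_neq0 // !mulr1 mulrC.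
Qed.

Lemma tofrac_injective : injective tofrac.
Proof. by move=> p r /eqP; rewrite tofrac_eq => /eqP. Qed.

Lemma rderiv_frac j (n d : R) : d != 0 ->
  rderiv j (tofrac n / tofrac d) = tofrac (n^`M(j) * d - n * d^`M(j)) / tofrac (d ^+ 2).
Proof.
move=> d0; rewrite /rderiv.
apply: (@quotient_rule_ext _ _ tofrac tofrac_injective) d0 (denom_ratioP _) _.
exact: (frac_reprE (tofrac n / tofrac d)).
Qed.

Fact ratconst_zmod : zmod_morphism (@ratconst F).
Proof. by move=> a b; rewrite /ratconst mpolyCB tofracB. Qed.
Fact ratconst_monoid : monoid_morphism (@ratconst F).
Proof. by split=> [|a b]; rewrite /ratconst ?mpolyC1 ?tofrac1 // mpolyCM tofracM. Qed.
HB.instance Definition _ := GRing.isZmodMorphism.Build F L (@ratconst F) ratconst_zmod.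
HB.instance Definition _ := GRing.isMonoidMorphism.Build F L (@ratconst F) ratconst_monoid.

End FunctionField.

(** * Polynomials with equal logarithmic derivatives *)

Section LogarithmicDerivative.
Variables (F : numFieldType) (n : nat).
Implicit Types p a b : {mpoly F[n]}.

Lemma mcoeff_sum p m : p@_m = \sum_(k <- msupp p) p@_k * (k == m)%:R.
Proof.
rewrite {1}[p]mpolyE raddf_sum; apply: eq_bigr => k _.
by rewrite /= mcoeffZ mcoeffX.
Qed.

Lemma mcoeff_euler p j m : ('X_j * p^`M(j))@_m = (m j)%:R * p@_m.
Proof.
rewrite {1}[p]mpolyE (raddf_sum (mderiv j)) mulr_sumr raddf_sum /=.
rewrite [in RHS]mcoeff_sum mulr_sumr; apply: eq_bigr => k _.
rewrite /= mderivZ mderivX -!scalerAr !mcoeffZ.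
have [k0|kj] := posnP (k j).
  by case: eqP => [<-|_]; rewrite ?k0 ?mul0r !mulr0.
rewrite -mpolyXD addmC submK; last first.
  by apply/mnm_lepP => i; rewrite mnm1E; case: eqP => [<-|].
by rewrite mcoeffX; case: eqP => [<-|_]; rewrite ?mulr0 // !mulr1 mulrC.
Qed.

Lemma mlead_euler p j : (mlead ('X_j * p^`M(j)) <= mlead p)%O.
Proof.
have [->|e0] := eqVneq ('X_j * p^`M(j)) 0; first by rewrite mlead0 le0m.
apply: msupp_le_mlead; have := mlead_supp e0.
by rewrite !mcoeff_msupp mcoeff_euler mulf_eq0 negb_or => /andP[].
Qed.

(** The Euler operator ['X_j * d/dX_j] scales each monomial by its exponent. Comparing coefficients
    at the product of the leading monomials equates their exponents, in characteristic 0. *)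
Lemma log_derivative_mlead a b : a != 0 -> b != 0 ->
  (forall j, a^`M(j) * b = a * b^`M(j)) -> mlead a = mlead b.
Proof.
move=> a0 b0 ab; apply/mnmP => j.
have E : 'X_j * a^`M(j) * b = a * ('X_j * b^`M(j)) by rewrite -mulrA ab mulrCA.
have ma0 : mleadc a != 0 by rewrite mleadc_eq0.
have mb0 : mleadc b != 0 by rewrite mleadc_eq0.
have /(@natr_inj_numField F) // : (mlead a j)%:R = (mlead b j)%:R :> F.
apply: (mulIf (mulf_neq0 ma0 mb0)).
have := congr1 (fun p => p@_(mlead a + mlead b)) E; rewrite /=.
rewrite !mleadcMW ?mlead_euler ?Order.POrderTheory.lexx // !mcoeff_euler => {}E.
by rewrite mulrA E mulrCA.
Qed.

(** Choose [c] so that [a - c *: b] loses its coefficient at [mlead b]. If nonzero, the difference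
    would satisfy the same equation and hence have leading monomial [mlead b]. *)
Lemma log_derivative_proportional a b : b != 0 ->
  (forall j, a^`M(j) * b = a * b^`M(j)) -> exists c, a = c *: b.
Proof.
move=> b0 ab; have [->|a0] := eqVneq a 0; first by exists 0; rewrite scale0r.
have mb0 : mleadc b != 0 by rewrite mleadc_eq0.
have lab := log_derivative_mlead a0 b0 ab.
exists (mleadc a / mleadc b); set c := _ / _; apply/eqP; rewrite -subr_eq0.
apply: contraT => d0.
have : mlead (a - c *: b) = mlead b.
  apply: log_derivative_mlead => // j.
  by rewrite mderivB mderivZ !mulrBl ab -!scalerAl [b * _]mulrC.
move=> ld; have := mleadc_eq0 (a - c *: b); rewrite (negPf d0) ld.
by rewrite mcoeffB mcoeffZ /c -lab divfK ?subrr ?eqxx // lab.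
Qed.

End LogarithmicDerivative.

(** * Birational maps are dominant *)

Section AffineChart.
Variable F : numFieldType.
Local Notation R := {mpoly F[2]}.
Local Notation tofrac := (@FracField.tofrac {mpoly F[2]}).

Definition chart : 3.-tuple R := [tuple 1; 'X_0; 'X_1].

Lemma dehomogE p : dehomog p = tofrac (p \mPo chart).
Proof.
rewrite /dehomog /comp_mpoly /mmap rmorph_sum; apply: eq_bigr => m _.
rewrite rmorphM; congr (_ * _); rewrite /mmap1 rmorph_prod; apply: eq_bigr => i _.
rewrite rmorphXn; congr (_ ^+ _).
by case: i => -[|[|[|//]]] lt; rewrite !(tnth_nth 0) /= ?tofrac1.
Qed.

Lemma chartX m : 'X_[m] \mPo chart = 'X_[affine_mon (m 1) (m 2)] :> R.
Proof.
rewrite comp_mpolyX !big_ord_recl big_ord0 mulr1 !(tnth_nth 0) /= expr1n mul1r.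
rewrite !mpolyXn -mpolyXD; congr ('X_[_ *+ m _ + _ *+ m _]); exact: val_inj.
Qed.

(** In a fixed degree a monomial is determined by its exponents in the last two variables. *)
Lemma chart_inj d (p : {mpoly F[3]}) : p \is d.-homog -> p \mPo chart = 0 -> p = 0.
Proof.
move=> hp p0; apply/mpolyP => m; rewrite mcoeff0.
have [dm|] := eqVneq (mdeg m) d; last exact: dhomog_nemf_coeff.
have := congr1 (fun q : R => q@_(affine_mon (m 1) (m 2))) p0; rewrite /= mcoeff0 => <-.
rewrite {2}[p]mpolyE (raddf_sum (comp_mpoly chart)) raddf_sum /=.
rewrite [LHS]mcoeff_sum; apply: eq_big_seq => k kp.
rewrite comp_mpolyZ chartX mcoeffZ mcoeffX; congr (_ * (nat_of_bool _)%:R).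
apply/eqP/eqP => [->//|/affine_mon_inj [k1 k2]].
have dk : mdeg k = d by exact: (dhomog_mf hp).
move: dm; rewrite -dk !mdegE !big_ord_recl !big_ord0 => e.
have l1 : lift ord0 ord0 = 1 :> 'I_3 by apply: val_inj.
have l2 : lift ord0 (lift ord0 ord0) = 2 :> 'I_3 by apply: val_inj.
rewrite l1 l2 k1 k2 !addn0 in e; apply/mnmP => i.
have [->|->|->] : [\/ i = ord0, i = 1 | i = 2]; rewrite ?k1 ?k2 //; last first.
  by apply/eqP; rewrite eq_sym -(eqn_add2r (m 1%R + m 2%R)%N) e.
by case: i => -[|[|[|//]]] lt; [constructor 1|constructor 2|constructor 3]; apply: val_inj.
Qed.

(* The substitution of [a0, a1, a2] in the homogenization, of degree [D + D], of
   the polynomial with coefficients [c]. *)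
Definition homogenized (A : comNzRingType) D (c : nat -> nat -> A) (a0 a1 a2 : A) : A :=
  \sum_(i < D.+1) \sum_(j < D.+1) c i j * (a0 ^+ (D - i + (D - j)) * a1 ^+ i * a2 ^+ j).

Lemma rmorph_homogenized (A B : comNzRingType) (f : {rmorphism A -> B}) D c a0 a1 a2 :
  f (homogenized D c a0 a1 a2) = homogenized D (fun i j => f (c i j)) (f a0) (f a1) (f a2).
Proof.
rewrite rmorph_sum; apply: eq_bigr => i _; rewrite rmorph_sum; apply: eq_bigr => j _.
by rewrite !rmorphM !rmorphXn.
Qed.

Lemma homogenizedM (A : comNzRingType) D (c : nat -> nat -> A) P a0 a1 a2 :
  homogenized D c (P * a0) (P * a1) (P * a2) = P ^+ (D + D) * homogenized D c a0 a1 a2.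
Proof.
rewrite mulr_sumr; apply: eq_bigr => i _; rewrite mulr_sumr; apply: eq_bigr => j _.
have id : (i <= D)%N by rewrite -ltnS.
have jd : (j <= D)%N by rewrite -ltnS.
have -> : (D + D = (D - i + (D - j)) + (i + j))%N by lia.
rewrite !exprMn !(exprD P); move: (P ^+ (D - i)) (P ^+ (D - j)) (P ^+ i) (P ^+ j).
move: (a0 ^+ _) (a1 ^+ _) (a2 ^+ _) => u0 u1 u2 p1 p2 p3 p4; ring.
Qed.

Lemma homogenized_homog D (c : nat -> nat -> F) e (a : 3.-tuple {mpoly F[3]}) :
  (forall i, tnth a i \is e.-homog) ->
  homogenized D (fun i j => (c i j)%:MP) (tnth a 0) (tnth a 1) (tnth a 2) \is (e * (D + D)).-homog.
Proof.
move=> ha; apply: rpred_sum => i _; apply: rpred_sum => j _.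
have id : (i <= D)%N by rewrite -ltnS.
have jd : (j <= D)%N by rewrite -ltnS.
have -> : (e * (D + D) = 0 + (e * (D - i + (D - j)) + e * i + e * j))%N.
  by rewrite add0n -!mulnDr; congr muln; lia.
apply: dhomogM; last by do 2?[apply: dhomogM]; apply: dhomogMn.
by rewrite -[(c i j)%:MP]mulr1 mul_mpolyC; apply: dhomogZ; exact: dhomog1.
Qed.

End AffineChart.

(** * Dominance and coordinates of quadratic maps *)

Section Dominance.
Variable F : numFieldType.
Local Notation R := {mpoly F[2]}.
Local Notation tofrac := (@FracField.tofrac {mpoly F[2]}).

Lemma homogenized_fraction (K : fieldType) (t Phi : {rmorphism R -> K}) (a : 'I_3 -> R) D (p : R) :
  t (a 0) != 0 -> (forall c, Phi c%:MP = t c%:MP) ->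
  (forall i, Phi 'X_i = t (a (lift ord0 i)) / t (a 0)) -> (msize p <= D.+1)%N ->
  t (homogenized D (fun i j => (p@_(affine_mon i j))%:MP) (a 0) (a 1) (a 2)) =
  t (a 0) ^+ (D + D) * Phi p.
Proof.
move=> a0 PhiC PhiX pD; rewrite rmorph_homogenized {2}[p](affine_expand pD).
rewrite [Phi _]rmorph_sum mulr_sumr; apply: eq_bigr => i _.
rewrite [Phi _]rmorph_sum mulr_sumr; apply: eq_bigr => j _.
have id : (i <= D)%N by rewrite -ltnS.
have jd : (j <= D)%N by rewrite -ltnS.
have -> : (D + D = (D - i + (D - j)) + (i + j))%N by lia.
have l1 : lift ord0 (0 : 'I_2) = 1 by apply: val_inj.
have l2 : lift ord0 (1 : 'I_2) = 2 by apply: val_inj.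
rewrite !rmorphM !rmorphXn PhiC !PhiX l1 l2.
exact: clear_denominators.
Qed.

Lemma homogenized_chart D (p : R) : (msize p <= D.+1)%N ->
  homogenized D (fun i j => (p@_(affine_mon i j))%:MP) 1 'X_0 'X_1 = p.
Proof.
move=> pD; rewrite [RHS](affine_expand pD); apply: eq_bigr => i _; apply: eq_bigr => j _.
by rewrite expr1n mul1r mulrA.
Qed.

Lemma mpolyX_neq0 n (m : 'X_{1..n}) : ('X_[m] : {mpoly F[n]}) != 0.
Proof.
by apply/eqP => /(congr1 (mcoeff m)) /eqP; rewrite mcoeffX eqxx mcoeff0 oner_eq0.
Qed.

Section Birational.
Variables (e : nat) (g : 3.-tuple {mpoly F[3]}).
Hypothesis g_bir : birational e g.

Lemma birational_tnth0 : tnth g 0 \mPo chart F != 0.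
Proof.
have [[hg _] [e' [g' [_ [P P0 gP] _]]]] := g_bir.
apply/eqP => /(chart_inj (hg 0)) g0; have := gP 0; rewrite g0 comp_mpoly0 => /esym/eqP.
by rewrite mulf_eq0 (negPf P0) (negPf (mpolyX_neq0 _)).
Qed.

(** If [Phi p] is 0, the homogenization of [p] vanishes at [g]. Composing with the inverse [g']
    turns [g] into a nonzero multiple of the coordinates, and restricting to the chart returns
    [p = 0]. *)
Lemma birational_dominant (K : fieldType) (t Phi : {rmorphism R -> K}) :
  injective t -> (forall c, Phi c%:MP = t c%:MP) ->
  (forall i, Phi 'X_i = t (tnth g (lift ord0 i) \mPo chart F) / t (tnth g 0 \mPo chart F)) ->
  forall p : R, p != 0 -> Phi p != 0.
Proof.
move=> t_inj PhiC PhiX p; apply: contraNneq => Phip.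
pose D := msize p; have pD : (msize p <= D.+1)%N by exact: leqnSn.
pose c i j := p@_(affine_mon i j).
have g0 : t (tnth g 0 \mPo chart F) != 0.
  by rewrite embedding_eq0 // birational_tnth0.
have := @homogenized_fraction K t Phi (fun i => tnth g i \mPo chart F) D p g0 PhiC PhiX pD.
rewrite Phip mulr0 -(rmorph0 t) => /t_inj H.
pose G := homogenized D (fun i j => (c i j)%:MP) (tnth g 0) (tnth g 1) (tnth g 2).
have [[hg _] [e' [g' [_ [P P0 gP] _]]]] := g_bir.
have G0 : G = 0.
  apply: (chart_inj (homogenized_homog D c hg)).
  rewrite -[RHS]H (rmorph_homogenized (comp_mpoly (chart F))).
  by congr homogenized; apply/funext => i; apply/funext => j; exact: comp_mpolyC.
have : G \mPo g' = 0 by rewrite G0 comp_mpoly0.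
rewrite (rmorph_homogenized (comp_mpoly g')) /= !gP homogenizedM => /eqP.
rewrite mulf_eq0 expf_eq0 (negPf P0) andbF /= => /eqP /(congr1 (comp_mpoly (chart F))).
rewrite (rmorph_homogenized (comp_mpoly (chart F))) /= comp_mpoly0 !comp_mpolyXU.
rewrite -(homogenized_chart pD) => e0; apply/eqP; rewrite -[RHS]e0.
congr homogenized.
by apply/funext => i; apply/funext => j; rewrite !comp_mpolyC.
Qed.

End Birational.

Lemma quad_monomial_inj : injective (tnth quad_monomials).
Proof.
move=> k k' e.
have : quad_expx k = quad_expx k' /\ quad_expy k = quad_expy k' by rewrite /quad_expx /quad_expy e.
rewrite !(quad_expE _).1 !(quad_expE _).2 => -[].
by case: k {e} => -[|[|[|[|[|[|//]]]]]] ?; case: k' => -[|[|[|[|[|[|//]]]]]] ? //= _ _; apply: val_inj.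
Qed.

Lemma mdeg_quad_monomial k : mdeg (tnth quad_monomials k) = 2.
Proof.
by case: k => -[|[|[|[|[|[|//]]]]]] ?; rewrite (tnth_nth 0%MM) /= mdegD !mdeg1.
Qed.

Lemma quad_monomial_surj (m : 'X_{1..3}) : mdeg m = 2 -> exists k, m = tnth quad_monomials k.
Proof.
move=> dm; have sum3 (m' : 'X_{1..3}) : mdeg m' = (m' 0%R + (m' 1%R + m' 2%R))%N.
  rewrite mdegE !big_ord_recl big_ord0 addn0.
  by congr (m' _ + (m' _ + m' _))%N; apply: val_inj.
have [k [kx ky]] : exists k : 'I_6, quad_expx k = m 1 /\ quad_expy k = m 2.
  move: dm; rewrite sum3; move: (m 0%R) (m 1%R) (m 2%R) => a b c.
  move: b c => [|[|[|b]]] [|[|[|c]]]; rewrite ?addnS ?addn0 // => abc;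
  [exists (inord 0)|exists (inord 2)|exists (inord 5)|exists (inord 1)|exists (inord 4)|exists (inord 3)];
  by rewrite (quad_expE _).1 (quad_expE _).2 inordK.
exists k; apply/mnmP => i.
have := dm; rewrite -(mdeg_quad_monomial k) !sum3 -/(quad_expx k) -/(quad_expy k) kx ky.
move/eqP; rewrite eqn_add2r => /eqP m0.
have [->|->|->] // : [\/ i = 0, i = 1 | i = 2].
by case: i => -[|[|[|//]]] lt; [constructor 1|constructor 2|constructor 3]; apply: val_inj.
Qed.

Lemma quad_chart (p : {mpoly F[3]}) : p \is 2.-homog ->
  p \mPo chart F = \sum_k (p@_(tnth quad_monomials k))%:MP * 'X_0 ^+ quad_expx k * 'X_1 ^+ quad_expy k.
Proof.
move=> hp.
have pE : p = \sum_k p@_(tnth quad_monomials k) *: 'X_[tnth quad_monomials k].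
  apply/mpolyP => m; rewrite raddf_sum /=.
  have [dm|dm] := eqVneq (mdeg m) 2; last first.
    rewrite (dhomog_nemf_coeff hp) // big1 // => k _; rewrite mcoeffZ mcoeffX.
    case: eqP => [e|]; last by rewrite mulr0.
    by move: dm; rewrite -e mdeg_quad_monomial.
  have [k ->] := quad_monomial_surj dm.
  rewrite (bigD1 k) //= mcoeffZ mcoeffX eqxx mulr1 big1 ?addr0 // => k' kk.
  by rewrite mcoeffZ mcoeffX (inj_eq quad_monomial_inj) (negPf kk) mulr0.
rewrite {1}pE raddf_sum; apply: eq_bigr => k _.
by rewrite /= comp_mpolyZ chartX -mul_mpolyC mpolyXD -!mpolyXn mulrA.
Qed.

End Dominance.

(** * The generic quadratic birational map *)

Section Scaling.
Variables (A : comNzRingType) (d : nat) (v : 'I_3 -> 'I_6 -> A) (x y c : A).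
Let cv i k := c * v i k.

Lemma quadZ i : quad cv x y i = c * quad v x y i.
Proof. by rewrite mulr_sumr; apply: eq_bigr => k _; rewrite !mulrA. Qed.
Lemma quad_dxZ i : quad_dx cv x y i = c * quad_dx v x y i.
Proof. by rewrite mulr_sumr; apply: eq_bigr => k _; rewrite !mulrA. Qed.
Lemma quad_dyZ i : quad_dy cv x y i = c * quad_dy v x y i.
Proof. by rewrite mulr_sumr; apply: eq_bigr => k _; rewrite !mulrA. Qed.

(** The pulled back coefficients have degree [2 * d] in [v] and the numerators of the derivatives
    degree 2. This homogeneity makes the condition on the map conic. *)
Lemma invariance_coefZ (s t : coef_index d) :
  invariance_coef cv x y s t = c ^+ (d + d + 2) * invariance_coef v x y s t.
Proof.
case: s t => -[i j] k [[i' j'] k'] /=.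
rewrite /quotient_dx /quotient_dy !quadZ quad_dxZ quad_dyZ.
rewrite [quad_dx cv x y 0]quad_dxZ [quad_dy cv x y 0]quad_dyZ !exprMn.
have jd : (j <= d)%N by rewrite -ltnS.
have kd : (k <= d)%N by rewrite -ltnS.
have -> : (d + d + 2 = (d - j + (d - k)) + j + k + 2)%N by lia.
rewrite ![c ^+ (_ + 2)]exprD ![c ^+ (_ + k)]exprD ![c ^+ (_ + j)]exprD.
move: (c ^+ _) (c ^+ _) (c ^+ _) => c1 c2 c3.
move: (_ ^+ (d - j + (d - k))) (_ ^+ j) (_ ^+ k) => q0 q1 q2.
move: (x ^+ _ * _) (quad_dx _ _ _ _) (quad_dx _ _ _ _) (quad_dy _ _ _ _) (quad_dy _ _ _ _).
move: (quad _ _ _ _) (quad _ _ _ _) => r0 r1 m u0 u1 w0 w1.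
by case: ifP => _; ring.
Qed.

Lemma invariance_formZ (w : coef_index d -> A) :
  invariance_form cv x y w = c ^+ (d + d + 2) * invariance_form v x y w.
Proof.
rewrite !invariance_formE mulr_sumr; apply: eq_bigr => s _.
by rewrite mulr_sumr; apply: eq_bigr => t _; rewrite invariance_coefZ mulrCA.
Qed.

End Scaling.

Lemma cancel_factor (K : fieldType) (h a b : K) : h != 0 -> h * a / (h * b) = a / b.
Proof. by move=> h0; rewrite -mulf_div divff // mul1r. Qed.

Section BirationalQuadratic.
Variable F : numFieldType.
Local Notation R := {mpoly F[2]}.
Local Notation tofrac := (@FracField.tofrac {mpoly F[2]}).

Lemma rderiv_quotient j (a b : R) : b != 0 ->
  rderiv j (tofrac a / tofrac b) = tofrac (b * a^`M(j) - a * b^`M(j)) / tofrac b ^+ 2.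
Proof. by move=> b0; rewrite rderiv_frac // [b * _]mulrC [tofrac (b ^+ 2)]tofracXn. Qed.

Definition coords (f : 3.-tuple {mpoly F[3]}) (a : 'I_(3 * 6)) : F := rat2_coords f ord0 a.

Lemma coordsE f i k : coords f (mxvec_index i k) = (tnth f i)@_(tnth quad_monomials k).
Proof. by rewrite /coords /rat2_coords mxvecE mxE. Qed.

(** If both partial derivatives vanish, numerator and denominator have equal logarithmic
    derivatives, so they are proportional. *)
Lemma rdifferential_neq0 (r : funfield F) : nonconstant r -> rdifferential r != 0.
Proof.
move=> rN; apply/eqP => /rowP r0; have d0 := denom_ratioP (repr r).
have [j|c ec] := @log_derivative_proportional F 2 \n_(repr r) \d_(repr r) d0.
  have := r0 j; rewrite !mxE /rderiv => /eqP.
  rewrite mulf_eq0 invr_eq0 !tofrac_eq0 expf_eq0 (negPf d0) orbF subr_eq0.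
  by move=> /eqP.
apply: (rN c); rewrite [LHS]frac_reprE ec -mul_mpolyC tofracM mulfK //.
by rewrite tofrac_eq0.
Qed.

(** The common factor [h] cancels in the affine chart, so the substitution is that of the birational
    [g] and therefore dominant; denominators of the form can then be cleared. *)
Lemma Bir2_invariance_form f : Bir2 f -> has_invariant_foliation f ->
  exists d (z : coef_index d -> F), (exists s, z s != 0) /\
    invariance_form (fun i k => (coords f (mxvec_index i k))%:MP) 'X_0 'X_1
      (fun s => (z s)%:MP) = 0 :> R.
Proof.
move=> [[hf [i0 fi0]] [e [h [g [_ fhg g_bir]]]]] [w w0 inv].
pose v i k := coords f (mxvec_index i k).
pose q : 'I_3 -> R := quad (fun i k => (v i k)%:MP) 'X_0 'X_1.
have fq i : tnth f i \mPo chart F = q i.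
  rewrite quad_chart //; apply: eq_bigr => k _.
  by rewrite /v coordsE.
have G0 := birational_tnth0 g_bir.
have g0 : tnth g 0 != 0 by apply: contra_neq G0 => ->; rewrite comp_mpoly0.
have h0 : h != 0 by apply: contra_neq fi0 => h0; rewrite fhg h0 mul0r.
have q0 : q 0 != 0.
  rewrite -fq; apply/eqP => /(chart_inj (hf 0)) /eqP.
  by rewrite fhg mulf_eq0 (negPf h0) (negPf g0).
pose phi := affine_map f.
have phiq i : phi i = tofrac (q (lift ord0 i)) / tofrac (q 0).
  by rewrite /phi /affine_map !dehomogE !fq.
pose Phi : {rmorphism R -> funfield F} := mmap (@ratconst F) phi.
have PhiC c : Phi c%:MP = tofrac c%:MP by rewrite /Phi /= mmapC.
have PhiX i : Phi 'X_i = tofrac (q (lift ord0 i)) / tofrac (q 0).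
  by rewrite /Phi /= mmapX mmap1U phiq.
have H0 : tofrac (h \mPo chart F) != 0.
  rewrite tofrac_eq0; apply: contra_neq q0 => H0.
  by rewrite -fq fhg rmorphM /= H0 mul0r.
have dominant : forall p : R, p != 0 -> Phi p != 0.
  apply: (birational_dominant g_bir (@tofrac_injective F) PhiC) => i.
  rewrite PhiX -!fq !fhg !(rmorphM (comp_mpoly (chart F))) /= !tofracM.
  exact: cancel_factor.
pose n i := \n_(repr (w ord0 i)); pose dn i := \d_(repr (w ord0 i)).
have dn0 i : dn i != 0 by apply: denom_ratioP.
have wE i : w ord0 i = tofrac (n i) / tofrac (dn i) by exact: frac_reprE.
apply: (invariance_form_of_fractions (@tofrac_injective F) (v := v) q0 PhiC PhiX dominant (n := n) dn0) => //.
  rewrite -negb_and; apply: contra w0 => /andP[/eqP n0 /eqP n1].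
  apply/eqP/rowP => i; rewrite mxE wE.
  have [->|->] : i = 0 \/ i = 1 by case: i => -[|[|//]] lt; [left|right]; apply: val_inj.
    by rewrite n0 tofrac0 mul0r.
  by rewrite n1 tofrac0 mul0r.
have dxE i : quotient_dx (fun i k => (v i k)%:MP) 'X_0 'X_1 i =
    q 0 * (q (lift ord0 i))^`M(0) - q (lift ord0 i) * (q 0)^`M(0).
  by rewrite /quotient_dx -!mderiv_quad_dx.
have dyE i : quotient_dy (fun i k => (v i k)%:MP) 'X_0 'X_1 i =
    q 0 * (q (lift ord0 i))^`M(1) - q (lift ord0 i) * (q 0)^`M(1).
  by rewrite /quotient_dy -!mderiv_quad_dy.
have dphi0 i : rderiv 0 (phi i) = tofrac (quotient_dx (fun i k => (v i k)%:MP) 'X_0 'X_1 i)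
    / tofrac (q 0) ^+ 2.
  by rewrite phiq (rderiv_quotient _ _ q0) dxE.
have dphi1 i : rderiv 1 (phi i) = tofrac (quotient_dy (fun i k => (v i k)%:MP) 'X_0 'X_1 i)
    / tofrac (q 0) ^+ 2.
  by rewrite phiq (rderiv_quotient _ _ q0) dyE.
have rc i : rcomp phi (w ord0 i) = Phi (n i) / Phi (dn i) by [].
have pb j : pullback phi w ord0 j =
    rcomp phi (w ord0 0) * rderiv j (phi 0) + rcomp phi (w ord0 1) * rderiv j (phi 1).
  by rewrite /pullback mxE; exact: sum_ord2.
have := inv; rewrite /invariant_form /wedge -/phi !pb !rc !dphi0 !dphi1 (wE 0) (wE 1).
by [].
Qed.

End BirationalQuadratic.

(** * The special map as an element of [Bir2] *)

Section SpecialQuadraticMap.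
Variable F : numFieldType.
Local Notation R3 := {mpoly F[3]}.

Definition special_map : 3.-tuple R3 := [tuple 'X_0 ^+ 2; 'X_0 * 'X_2; 'X_1 * 'X_2 + 'X_0 ^+ 2].
(** Homogeneous form of [(x, y) |-> ((y - 1) / x, x)]. *)
Definition special_inverse : 3.-tuple R3 := [tuple 'X_0 * 'X_1; ('X_2 - 'X_0) * 'X_0; 'X_1 ^+ 2].

Lemma ord3P (P : 'I_3 -> Prop) : P 0 -> P 1 -> P 2 -> forall i, P i.
Proof.
move=> P0 P1 P2 i.
have [->|->|->] // : [\/ i = 0, i = 1 | i = 2].
by case: i => -[|[|[|//]]] lt; [constructor 1|constructor 2|constructor 3]; apply: val_inj.
Qed.

Lemma dhomogXX (i j : 'I_3) : ('X_i * 'X_j : R3) \is 2.-homog.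
Proof. by rewrite -mpolyXD dhomogX; apply/eqP; rewrite [LHS](mdegD U_(i) U_(j)) !mdeg1. Qed.

Lemma special_map_homog i : tnth special_map i \is 2.-homog.
Proof.
by move: i; apply: ord3P; rewrite (tnth_nth 0) /= ?expr2 ?rpredD ?dhomogXX.
Qed.

Lemma special_inverse_homog i : tnth special_inverse i \is 2.-homog.
Proof.
by move: i; apply: ord3P; rewrite (tnth_nth 0) /= ?expr2 ?mulrBl ?rpredB ?dhomogXX.
Qed.

Lemma special_comp : comp_is_id special_map special_inverse.
Proof.
exists ('X_0 * 'X_1 ^+ 2); first by rewrite mulf_neq0 ?expf_neq0 ?mpolyX_neq0.
apply: ord3P; rewrite (tnth_nth 0) /=.
- by rewrite rmorphXn /= comp_mpolyXU /=; ring.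
- by rewrite rmorphM /= !comp_mpolyXU /=; ring.
- by rewrite rmorphD rmorphM rmorphXn /= !comp_mpolyXU /=; ring.
Qed.

Lemma special_comp_inverse : comp_is_id special_inverse special_map.
Proof.
exists ('X_0 ^+ 2 * 'X_2); first by rewrite mulf_neq0 ?expf_neq0 ?mpolyX_neq0.
apply: ord3P; rewrite (tnth_nth 0) /=.
- by rewrite rmorphM /= !comp_mpolyXU /=; ring.
- by rewrite rmorphM rmorphB /= !comp_mpolyXU /=; ring.
- by rewrite rmorphXn /= comp_mpolyXU /=; ring.
Qed.

Lemma special_birational : birational 2 special_map.
Proof.
split; first by split; [exact: special_map_homog | exists 0; rewrite (tnth_nth 0) /= expf_neq0 ?mpolyX_neq0].
exists 2, special_inverse; split; [|exact: special_comp|exact: special_comp_inverse].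
split; first exact: special_inverse_homog.
by exists 0; rewrite (tnth_nth 0) /= mulf_neq0 ?mpolyX_neq0.
Qed.

(** A common divisor divides both ['X_0 ^+ 2] and ['X_1 * 'X_2]; its leading monomial divides these
    two coprime monomials, so it is a constant. *)
Lemma special_coprime k : (forall i, mdivides k (tnth special_map i)) -> mdivides k 1.
Proof.
move=> kd; have [r0 e0] := kd 0; have [r2 e2] := kd 2.
rewrite (tnth_nth 0) /= in e0; rewrite (tnth_nth 0) /= e0 in e2.
have e12 : 'X_1 * 'X_2 = (r2 - r0) * k by rewrite mulrBl -e2 addrK.
have nz1 : ('X_0 ^+ 2 : R3) != 0 by rewrite expf_neq0 ?mpolyX_neq0.
have nz2 : ('X_1 * 'X_2 : R3) != 0 by rewrite mulf_neq0 ?mpolyX_neq0.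
have := nz1; have := nz2; rewrite e0 e12 !mulf_eq0 !negb_or => /andP[s0 k0] /andP[r0N _].
have m1 : mlead ('X_0 ^+ 2 : R3) = (mlead r0 + mlead k)%MM by rewrite e0 mleadM.
have m2 : mlead ('X_1 * 'X_2 : R3) = (mlead (r2 - r0) + mlead k)%MM by rewrite e12 mleadM.
rewrite expr2 -!mpolyXD !mleadXm in m1 m2.
have mk : mlead k = 0%MM.
  apply/mnmP => i; rewrite mnm0E.
  have := congr1 (fun m : 'X_{1..3} => m i) m1; have := congr1 (fun m : 'X_{1..3} => m i) m2.
  rewrite /= !mnmDE !mnm1E; move: i; apply: ord3P => /=; lia.
have sk : (msize k <= 1)%N by rewrite -mlead_deg // mk mdeg0.
have kE := msize1_polyC sk; set c := k@_0 in kE.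
have c0 : c != 0 by apply: contra_neq k0 => c0; rewrite kE c0 mpolyC0.
by exists (c^-1)%:MP; rewrite kE -mpolyCM mulVf // mpolyC1.
Qed.

Lemma special_Bir2 : Bir2 special_map.
Proof.
split; first exact: special_birational.1.
exists 2, 1, special_map; split; last exact: special_birational.
  split=> [i|]; last exact: special_coprime.
  by exists (tnth special_map i); rewrite mulr1.
by move=> i; rewrite mul1r.
Qed.

Lemma special_coords : coords special_map =1 @special_point F.
Proof.
move=> a; case/mxvec_indexP: a => i k; rewrite coordsE /special_point mxvecE mxE.
have X0 : 'X_0 ^+ 2 = 'X_[tnth quad_monomials 0] :> R3 by rewrite expr2 -mpolyXD.
have X2 : 'X_0 * 'X_2 = 'X_[tnth quad_monomials 2] :> R3 by rewrite -mpolyXD.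
have X4 : 'X_1 * 'X_2 = 'X_[tnth quad_monomials 4] :> R3 by rewrite -mpolyXD.
move: i; apply: ord3P; rewrite (tnth_nth 0) /= ?X0 ?X2 ?X4 ?mcoeffD !mcoeffX
  !(inj_eq quad_monomial_inj) /special_coord;
  by case: k => -[|[|[|[|[|[|//]]]]]] ? /=; rewrite ?addr0 ?add0r.
Qed.

End SpecialQuadraticMap.

(** * The countable family of exceptional sets *)

Section InvariantLocus.
Variable F : numFieldType.

(** Closed subsets of projective space need homogeneous equations, so [P] is replaced by all its
    homogeneous components. *)
Definition homogeneous_locus (P : {mpoly F[3 * 6]}) (f : 3.-tuple {mpoly F[3]}) : Prop :=
  Bir2 f /\ forall k, (pihomog mdeg k P).@[coords f] = 0.

Lemma homogeneous_locus_algebraic P : algebraic_subset_Bir2 (homogeneous_locus P).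
Proof.
exists (fun p => exists k, p = pihomog mdeg k P); split=> [_ [k ->]|f].
  by exists k; exact: pihomogP.
split=> -[fB Pf]; split=> //; first by move=> _ [k ->]; exact: Pf.
by move=> k; apply: (Pf _); exists k.
Qed.

Lemma homogeneous_locus_proper P : P.@[@special_point F] != 0 ->
  proper_in_Bir2 (homogeneous_locus P).
Proof.
move=> P0; exists (special_map F); first exact: special_Bir2.
case=> _ Pf; case/eqP: P0; rewrite -(meval_eq _ (@special_coords F)).
rewrite (pihomog_partitionE (leqnn (mmeasure mdeg P))) raddf_sum big1 // => k _.
exact: Pf.
Qed.

Lemma generic_no_invariant_foliation : generic_Bir2 (fun f => ~ @has_invariant_foliation F f).
Proof.
have /choice [P HP] := @invariance_locus F.
exists (fun d => homogeneous_locus (P d)); split=> [d|f fB fZ fol].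
  split; first exact: homogeneous_locus_algebraic.
  by apply: homogeneous_locus_proper; exact: (HP d).1.
have [d [z [z0 E]]] := Bir2_invariance_form fB fol.
(* Scaling the coordinates by [c] preserves the invariance equation, so [P] vanishes on the whole
   line through them and each component vanishes too. *)
apply: (fZ d); split=> // k; apply: pihomog_vanish => c.
apply: ((HP d).2 _ z z0).
have vE : (fun i k => (c * coords f (mxvec_index i k))%:MP) =
    (fun i k => c%:MP * (coords f (mxvec_index i k))%:MP) :> (_ -> _ -> {mpoly F[2]}).
  by apply/funext => i; apply/funext => j; rewrite mpolyCM.
by rewrite vE invariance_formZ E mulr0.
Qed.

End InvariantLocus.

Theorem proposition4p7 (R : realType) :
  generic_Bir2 (fun f : 3.-tuple {mpoly (complex R)[3]} =>
    ~ has_invariant_fibration f) /\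
  generic_Bir2 (fun f : 3.-tuple {mpoly (complex R)[3]} =>
    ~ has_invariant_foliation f).
Proof.
have [Z [Zalg Zfol]] := generic_no_invariant_foliation (complex R).
split; last by exists Z.
(* The same exceptional sets serve for fibrations: the differential of a nonconstant component is a
   nonzero invariant form. *)
exists Z; split=> // f fB fZ [n [p [_ [i pN inv]]]].
by apply: (Zfol f fB fZ); exists (rdifferential (p i)); first exact: rdifferential_neq0.
Qed.
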